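(* Fix an integer $m\ge1$ and $\rho_0>0$. For small real $\delta$, let $\Omega=\Omega_\delta$ be the domain bounded by the curve $\theta\mapsto e^{\rho_0}(e^{i\theta}+\delta e^{-im\theta})$. Then, as $\delta\to0$, the Neumann-Poincaré operator $\mathcal{K}_\Omega^*$ on $V_s$ has eigenvalues and associated eigenfunctions with the following asymptotic expansions, where the eigenvalues are given up to order $\delta$ (error $O(\delta^2)$) and the eigenfunctions up to order $\delta^0$ (error $O(\delta)$). (i) If $m$ is odd, $m=2k-1$ with $k\in\mathbb{N}$: the eigenvalue $-\frac{\delta}{2}k+O(\delta^2)$ with eigenfunction $v_k^s+O(\delta)$; and, for each $1\le j\le k-1$ and each choice of sign, the eigenvalue $-\frac{\delta}{2}\big(\pm\sqrt{j(m+1-j)}\big)+O(\delta^2)$ with eigenfunction $\sqrt{j}\,v_j^s\pm\sqrt{m+1-j}\,v_{m+1-j}^s+O(\delta)$. (ii) If $m$ is even, $m=2k$ with $k\in\mathbb{N}$: for each $1\le j\le k$ and each choice of sign, the eigenvalue $-\frac{\delta}{2}\big(\pm\sqrt{j(m+1-j)}\big)+O(\delta^2)$ with eigenfunction $\sqrt{j}\,v_j^s\pm\sqrt{m+1-j}\,v_{m+1-j}^s+O(\delta)$.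
   Context: Identify $\mathbb{R}^2$ with $\mathbb{C}$. For a bounded domain $\Omega$ with smooth boundary and outward unit normal $\nu$, the Neumann-Poincaré operator on $L^2(\partial\Omega)$ is $$\mathcal{K}_\Omega^*[\varphi](x)=\frac1{2\pi}\int_{\partial\Omega}\frac{\langle x-y,\nu_x\rangle}{|x-y|^2}\varphi(y)\,d\sigma(y),\qquad x\in\partial\Omega.$$ The domain $\Omega_\delta$ arises from the conformal map $\Phi(\zeta)=\zeta+a\zeta^{-m}$ with $a=e^{(m+1)\rho_0}\delta\in\mathbb{R}$, assumed injective on $\{|\zeta|>1\}$ (which holds for $|\delta|$ small). Its boundary is $\partial\Omega=\{\Phi(e^{\rho_0+i\theta}):\theta\in[0,2\pi)\}$, and the complement of $\overline\Omega$ is $\Phi(\{|\zeta|>e^{\rho_0}\})$. On $\partial\Omega$, parametrized by $\theta$, let $J=J(\theta)=\left|\partial_\xi\big(\Phi(e^{\xi})\big)\big|_{\xi=\rho_0+i\theta}\right|=e^{\rho_0}|e^{i\theta}-m\delta e^{-im\theta}|$, so that $d\sigma=J\,d\theta$. Define functions on $\partial\Omega$ by $v_n^s=J^{-1}\sin n\theta$ for $n\ge1$, and let $V_s=\mathrm{span}\{v_1^s,v_2^s,\dots\}$ (closed span in $L^2(\partial\Omega)$). The error terms for eigenfunctions are measured in $L^2(\partial\Omega)$; eigenfunctions are determined up to normalization. *)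

(* Defs.v *)
From HB Require Import structures.
From mathcomp Require Import all_boot all_order all_algebra.
From mathcomp Require Import all_classical all_reals all_analysis.
From mathcomp Require Import measurable_realfun complex ring.

Set Implicit Arguments.
Unset Strict Implicit.
Unset Printing Implicit Defensive.

Import Order.TTheory GRing.Theory Num.Theory.
Import numFieldNormedType.Exports.

Local Open Scope classical_set_scope.
Local Open Scope ring_scope.
Local Open Scope complex_scope.

Section plane.
Context {R : realType}.

Definition dotC (z w : R[i]) : R :=
  complex.Re z * complex.Re w + complex.Im z * complex.Im w.

Definition absC (z : R[i]) : R := Num.sqrt (dotC z z).

Definition expi (t : R) : R[i] := cos t +i* sin t.

End plane.

Section neumann_poincare.
Context d {T : measurableType d} {R : realType}.

(* The boundary is described by a parameter space T, the position pos x of   *)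
(* the boundary point with parameter x, the outward unit normal nu x there,  *)
(* and the arc-length measure sigma pulled back to T; functions on the       *)
(* boundary are functions of the parameter. At pos y = pos x the kernel is   *)
(* 0 by the convention 0 / 0 = 0.                                            *)
Definition NP (sigma : {measure set T -> \bar R}) (pos nu : T -> R[i])
    (phi : T -> R) (x : T) : R :=
  (2 * pi)^-1 *
    \int[sigma]_y (dotC (pos x - pos y) (nu x) / absC (pos x - pos y) ^+ 2
                   * phi y).

Definition closed_span (sigma : {measure set T -> \bar R}) (v : nat -> T -> R) :
    set (T -> R) :=
  [set f | f \in Lfun sigma 2%:E /\
    forall e : R, 0 < e -> exists (N : nat) (c : nat -> R),
      ('N[sigma]_2%:E[EFin \o
          (f \- (fun x => \sum_(1 <= n < N.+1) c n * v n x))%R]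
         < e%:E)%E].

(* (lam, phi) is an eigenpair of the operator A acting on the subspace V     *)
(* of L^2(sigma), whose elements are identified when equal almost everywhere. *)
Definition is_eigenpair (sigma : {measure set T -> \bar R})
    (A : (T -> R) -> T -> R) (V : set (T -> R)) (lam : R) (phi : T -> R) :=
  [/\ V phi, ~ (phi = cst 0 %[ae sigma]) &
      A phi = (fun x => lam * phi x) %[ae sigma]].

End neumann_poincare.

Section domain.
Context {R : realType}.
Variables (m : nat) (rho0 delta : R).

Definition Phi (z : R[i]) : R[i] :=
  z + (expR (m.+1%:R * rho0) * delta)%:C * z ^- m.

Definition bdry (t : R) : R[i] :=
  (expR rho0)%:C * (expi t + delta%:C * expi (- (m%:R * t))).

(* The derivative of Phi (e^xi) in xi at xi = rho0 + i t. It is also the     *)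
(* derivative in rho at rho0 of Phi (e^(rho + i t)), so it is normal to the  *)
(* curve by conformality and points to the exterior Phi {|z| > e^rho0}.      *)
Definition dPhi (t : R) : R[i] :=
  (expR rho0)%:C * (expi t - (m%:R * delta)%:C * expi (- (m%:R * t))).

Definition J (t : R) : R := absC (dPhi t).

Definition normal (t : R) : R[i] := (J t)^-1%:C * dPhi t.

Definition arclength (A : set R) : \bar R :=
  (\int[lebesgue_measure]_(t in A `&` `[0%R, (2 * pi)%R[) (J t)%:E)%E.

Lemma Phi_polar (r t : R) : r != 0 ->
  Phi (r%:C * expi t) = r%:C * expi t
    + (expR (m.+1%:R * rho0) * delta * r ^- m)%:C * expi (- (m%:R * t)).
Proof.
move=> r0; rewrite /Phi; congr (_ + _).
have expiD (x y : R) : expi (x + y) = expi x * expi y.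
  by apply/eqP; rewrite eq_complex /= cosD sinD eqxx /=; apply/eqP; ring.
have expiX : expi t ^+ m = expi (m%:R * t).
  elim: m => [|n IH]; first by rewrite mul0r /expi cos0 sin0 expr0.
  by rewrite exprS IH -expiD; congr expi; rewrite -natr1; ring.
have expiK : expi (- (m%:R * t)) * expi (m%:R * t) = 1.
  by rewrite -expiD addNr /expi cos0 sin0.
have expi_neq0 : expi (m%:R * t) != 0.
  by apply/negP => /eqP e0; move: expiK; rewrite e0 mulr0 => /esym /eqP; rewrite oner_eq0.
have -> : expi (- (m%:R * t)) = (expi (m%:R * t))^-1.
  by rewrite -[LHS](mulfK expi_neq0) expiK mul1r.
rewrite exprMn expiX invfM !rmorphM /= !mulrA; congr (_ * _ * _).
by rewrite fmorphV rmorphXn.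
Qed.

Lemma bdry_Phi t : bdry t = Phi ((expR rho0)%:C * expi t).
Proof.
rewrite Phi_polar ?gt_eqF ?expR_gt0// /bdry mulrDr mulrA -rmorphM.
congr (_ + _%:C * _).
rewrite expRM_natl exprS; field.
by rewrite expf_neq0// gt_eqF ?expR_gt0.
Qed.

Lemma is_derive_Re_Phi t :
  is_derive rho0 1 (fun rho => complex.Re (Phi ((expR rho)%:C * expi t)))
    (complex.Re (dPhi t)).
Proof.
have -> : (fun rho => complex.Re (Phi ((expR rho)%:C * expi t))) =
    (fun rho => expR rho * cos t
      + expR (m.+1%:R * rho0) * delta * cos (- (m%:R * t))
        * expR (- (m%:R * rho))).
  apply/funext => rho; rewrite Phi_polar ?gt_eqF ?expR_gt0//=.
  by rewrite !mul0r !subr0 expRN !expRM_natl; ring.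
apply: is_derive_eq.
rewrite /= /GRing.scale /= !mul0r !subr0 expRN !expRM_natl exprS; field.
by rewrite expf_neq0// gt_eqF ?expR_gt0.
Qed.

Lemma is_derive_Im_Phi t :
  is_derive rho0 1 (fun rho => complex.Im (Phi ((expR rho)%:C * expi t)))
    (complex.Im (dPhi t)).
Proof.
have -> : (fun rho => complex.Im (Phi ((expR rho)%:C * expi t))) =
    (fun rho => expR rho * sin t
      + expR (m.+1%:R * rho0) * delta * sin (- (m%:R * t))
        * expR (- (m%:R * rho))).
  apply/funext => rho; rewrite Phi_polar ?gt_eqF ?expR_gt0//=.
  by rewrite !mul0r !addr0 expRN !expRM_natl; ring.
apply: is_derive_eq.
rewrite /= /GRing.scale /= !mul0r !addr0 expRN !expRM_natl exprS; field.
by rewrite expf_neq0// gt_eqF ?expR_gt0.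
Qed.

Lemma J_ge0 t : 0 <= J t.
Proof. exact: sqrtr_ge0. Qed.

Lemma continuous_J : continuous J.
Proof.
have cm : continuous (fun t : R => - (m%:R * t)).
  by move=> t; apply: cvgN; apply: cvgM; [exact: cvg_cst|exact: cvg_id].
have cc : continuous (fun t : R => cos (- (m%:R * t))).
  by move=> t; apply: (continuous_comp (cm t)); exact: continuous_cos.
have cs : continuous (fun t : R => sin (- (m%:R * t))).
  by move=> t; apply: (continuous_comp (cm t)); exact: continuous_sin.
have cre : continuous (fun t : R => complex.Re (dPhi t)).
  have -> : (fun t : R => complex.Re (dPhi t)) = (fun t : R =>
      expR rho0 * (cos t - m%:R * delta * cos (- (m%:R * t)))).
    by apply/funext => t /=; ring.
  move=> t; apply: cvgM; first exact: cvg_cst.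
  apply: cvgB; first exact: continuous_cos.
  by apply: cvgM; [exact: cvg_cst|exact: cc].
have cim : continuous (fun t : R => complex.Im (dPhi t)).
  have -> : (fun t : R => complex.Im (dPhi t)) = (fun t : R =>
      expR rho0 * (sin t - m%:R * delta * sin (- (m%:R * t)))).
    by apply/funext => t /=; ring.
  move=> t; apply: cvgM; first exact: cvg_cst.
  apply: cvgB; first exact: continuous_sin.
  by apply: cvgM; [exact: cvg_cst|exact: cs].
move=> t; apply: (@continuous_comp _ _ _ (fun t => dotC (dPhi t) (dPhi t))).
  by apply: cvgD; apply: cvgM; (exact: cre || exact: cim).
exact: sqrt_continuous.
Qed.

Lemma measurable_J : measurable_fun [set: R] J.
Proof. by apply: continuous_measurable_fun; exact: continuous_J. Qed.

Let arclength0 : arclength set0 = 0%E.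
Proof. by rewrite /arclength set0I integral_set0. Qed.

Let arclength_ge0 A : (0 <= arclength A)%E.
Proof. by apply: integral_ge0 => t _; rewrite lee_fin J_ge0. Qed.

Let arclength_sigma_additive : semi_sigma_additive arclength.
Proof.
move=> /= F mF tF mUF; rewrite /arclength; apply: cvg_toP.
  apply: ereal_nondecreasing_is_cvgn => i j ij.
  apply: lee_sum_nneg_natr => // k _ _; apply: integral_ge0 => t _.
  by rewrite lee_fin J_ge0.
rewrite setI_bigcupl ge0_integral_bigcup//=.
- by move=> k; apply: measurableI; [exact: mF|exact: measurable_itv].
- by apply: measurable_funTS; apply/measurable_EFinP; exact: measurable_J.
- by move=> t _; rewrite lee_fin J_ge0.
- exact: trivIset_setIr.
Qed.

HB.instance Definition _ := isMeasure.Build _ _ _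
  arclength arclength0 arclength_ge0 arclength_sigma_additive.

Definition vs (n : nat) (t : R) : R := (J t)^-1 * sin (n%:R * t).

Definition Vs : set (R -> R) := closed_span arclength vs.

Definition Kstar : (R -> R) -> R -> R := NP arclength bdry normal.

End domain.

(* For delta near 0, Kstar on Vs has an eigenvalue equal to lam0 delta up to *)
(* O(delta^2) whose eigenfunction, suitably normalized, is phi0 delta up to  *)
(* O(delta) in L^2 of the boundary.                                          *)
Definition eigen_expansion {R : realType} (m : nat) (rho0 : R)
    (lam0 : R -> R) (phi0 : R -> R -> R) :=
  exists (lam : R -> R) (phi : R -> R -> R) (C : R),
    \forall delta \near (0 : R),
      [/\ is_eigenpair (arclength m rho0 delta) (Kstar m rho0 delta)
            (Vs m rho0 delta) (lam delta) (phi delta),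
          `|lam delta - lam0 delta| <= C * delta ^+ 2 &
          ('N[arclength m rho0 delta]_2%:E[EFin \o (phi delta \- phi0 delta)%R]
             <= (C * `|delta|)%:E)%E].

(* Main.v *)
(* Write zeta = e^(it), w = e^(ix) and                                        *)
(*   S = sum_(1 <= p <= m) zeta^-p w^-(m+1-p)       (wave_sum),               *)
(*   P = sum_(1 <= p <= m) p zeta^-p w^-(m+1-p)     (dwave_sum).              *)
(* The boundary points satisfy                                                *)
(*   bdry t - bdry x = e^rho0 (zeta - w)(1 - delta S),                        *)
(* so that the Neumann-Poincare kernel in the parameters (t, x) is            *)
(*   J(t)^-1 (1/2 + Re (delta P / (1 - delta S))),                            *)
(* which is smooth. On functions J^-1 f with f in the uniform closure E of    *)
(* the sine polynomials the constant 1/2 disappears, so the operator acts on  *)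
(* f as delta A + delta^2 Q, where A has kernel Re P, Q has kernel            *)
(* Re (P S / (1 - delta S)), and both preserve E because only non-positive    *)
(* frequencies occur. The operator A is explicit and of finite rank: it maps  *)
(* sin (n t) to -((m+1-n)/2) sin ((m+1-n)t) for 1 <= n <= m and kills the     *)
(* other modes. Its nonzero eigenvalues are simple, with the eigenvectors     *)
(* announced in the theorem, and they persist under the bounded perturbation  *)
(* delta Q by a contraction argument in the sup norm.                         *)

Require Import Defs.
From HB Require Import structures.
From mathcomp Require Import all_boot all_order all_algebra.
From mathcomp Require Import all_classical all_reals all_analysis.
From mathcomp Require Import measurable_realfun complex ring lra zify.

Import Order.TTheory GRing.Theory Num.Theory.
Import numFieldNormedType.Exports.
Import Normc.

Local Open Scope classical_set_scope.
Local Open Scope ring_scope.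
Local Open Scope complex_scope.

(** * Perturbation of a simple eigenvalue *)

(** Conjugated by f -> J^-1 f, the Neumann-Poincare operator acts on [sine_closure] as delta (A +
    delta Q), with A fixed and of finite rank and Q bounded uniformly for small delta
    ([boundary_kernelE], [KstarE]). After division by delta the theorem is first-order perturbation
    theory: a simple nonzero eigenvalue nu of A yields an eigenvalue delta nu + O(delta^2).

    A exchanges sin (n t) and sin ((m+1-n) t) up to weights. It therefore splits into antidiagonal 2
    x 2 blocks, with one 1 x 1 block on the middle mode when m is odd, and is zero on the higher
    modes. The block of j has the eigenvalues plus or minus sqrt (j (m+1-j)) / 2, and these are
    simple because n (m+1-n) determines the pair formed by n and m+1-n ([mode_weight_resonant]).

    The perturbation step is a Lyapunov-Schmidt reduction ([simple_eigenvalue_perturbation]). The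
    eigenfunction is sought as g0 + u with b u = 0, where b is a left eigenvector of A. Solvability
    fixes the correction of the eigenvalue, and a right inverse of A - nu on ker b, explicit because
    A has finite rank ([reduced_resolvent]), turns the equation into a contraction.

    That Q preserves [sine_closure] comes from expanding 1 / (1 - delta S) in a geometric series of
    exponentials, each of which acts as a rank-one operator onto a sine ([kernel_op_wave],
    [sine_closure_remainder]). All estimates are made in the sup norm; they pass to L2 because the
    curve has finite length and J is bounded below ([Lnorm_arclength_le], [Vs_invJ]). *)

Definition uniformly_closed {R : realType} {T : Type} (E : set (T -> R)) :=
  forall f, (forall e : R, 0 < e ->
    exists2 g, E g & forall t, `|f t - g t| <= e) -> E f.

Definition combination_closed {R : realType} {T : Type} (E : set (T -> R)) :=
  forall (a : R) f g, E f -> E g -> E (a *: f + g).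

Definition linear_on {R : realType} {T : Type} {V : lmodType R}
    (E : set (T -> R)) (L : (T -> R) -> V) :=
  forall (a : R) f g, E f -> E g -> L (a *: f + g) = a *: L f + L g.

Section linear_on.
Context {R : realType} {T : Type}.
Variable E : set (T -> R).
Hypotheses (linE : combination_closed E) (E0 : E 0).

Lemma combination_closedD f g : E f -> E g -> E (f + g).
Proof. by move=> Ef Eg; have := linE 1 f g Ef Eg; rewrite scale1r. Qed.

Lemma combination_closedZ a f : E f -> E (a *: f).
Proof. by move=> Ef; have := linE a f 0 Ef E0; rewrite addr0. Qed.

Lemma combination_closed_sum (I : Type) (s : seq I) (F : I -> T -> R) :
  (forall i, E (F i)) -> E (\sum_(i <- s) F i).
Proof.
move=> EF; elim: s => [|i s IH]; first by rewrite big_nil.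
by rewrite big_cons; apply: combination_closedD.
Qed.

Variables (V : lmodType R) (L : (T -> R) -> V).
Hypothesis linL : linear_on E L.

Lemma linear_onD f g : E f -> E g -> L (f + g) = L f + L g.
Proof. by move=> Ef Eg; have := linL 1 f g Ef Eg; rewrite !scale1r. Qed.

Lemma linear_on0 : L 0 = 0.
Proof.
have := linear_onD _ _ E0 E0; rewrite addr0 => L0.
by apply: (addIr (L 0)); rewrite add0r -L0.
Qed.

Lemma linear_onZ a f : E f -> L (a *: f) = a *: L f.
Proof. by move=> Ef; have := linL a f 0 Ef E0; rewrite linear_on0 !addr0. Qed.

Lemma linear_onB f g : E f -> E g -> L (f - g) = L f - L g.
Proof.
move=> Ef Eg; rewrite -[- g]scaleN1r -[- L g]scaleN1r.
by rewrite linear_onD ?linear_onZ//; exact: combination_closedZ.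
Qed.

Lemma linear_on_sum (I : Type) (s : seq I) (F : I -> T -> R) :
  (forall i, E (F i)) -> L (\sum_(i <- s) F i) = \sum_(i <- s) L (F i).
Proof.
move=> EF; elim: s => [|i s IH]; first by rewrite !big_nil linear_on0.
rewrite !big_cons linear_onD ?IH//; exact: combination_closed_sum.
Qed.

End linear_on.

(** Banach's fixed point theorem on the unit ball of E, by iteration from 0. Sup norms enter as
    uniform bounds by an arbitrary c, so that no supremum is formed; pointwise completeness and
    closedness of E under uniform limits replace completeness of a normed space. *)
Lemma sup_norm_fixed_point {R : realType} {T : Type} (E : set (T -> R))
    (F : (T -> R) -> (T -> R)) :
  uniformly_closed E -> E (cst 0) ->
  (forall u, E u -> (forall t, `|u t| <= 1) ->
    E (F u) /\ forall t, `|F u t| <= 1) ->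
  (forall u v (c : R), E u -> E v -> (forall t, `|u t| <= 1) ->
    (forall t, `|v t| <= 1) -> (forall t, `|u t - v t| <= c) ->
    forall t, `|F u t - F v t| <= c / 2) ->
  exists u, [/\ E u, forall t, `|u t| <= 1 & F u = u].
Proof.
move=> clE E0 FE Fc.
pose u n := iter n F (cst 0).
have uE n : E (u n) /\ forall t, `|u n t| <= 1.
  elim: n => [|n [IH1 IH2]]; last exact: FE.
  by split => // t; rewrite /= normr0.
have du n t : `|u n.+1 t - u n t| <= 2^-1 ^+ n.
  elim: n t => [|n IH] t.
    by rewrite /= subr0 expr0; apply: (proj2 (uE 1%N)).
  rewrite exprSr; apply: (Fc (u n.+1) (u n)) => //;
    by [apply (uE _).1 | apply (uE _).2].
have duk n k t : `|u (n + k)%N t - u n t| <= 2 * 2^-1 ^+ n.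
  (* Subtracting the tail of the geometric series makes the induction on k close. *)
  suff : `|u (n + k)%N t - u n t| <= 2 * 2^-1 ^+ n - 2 * 2^-1 ^+ (n + k).
    move=> /le_trans; apply; by rewrite lerBlDr lerDl mulr_ge0// exprn_ge0//.
  elim: k => [|k IH]; first by rewrite addn0 !subrr normr0.
  rewrite addnS.
  have -> : u (n + k).+1 t - u n t =
    (u (n + k).+1 t - u (n + k)%N t) + (u (n + k)%N t - u n t) by ring.
  apply: le_trans (ler_normD _ _) _.
  apply: le_trans (lerD (du _ _) IH) _.
  rewrite [2^-1 ^+ (n + k).+1]exprS mulrA mulfV// mul1r.
  by set x := _ ^+ (n + k); set y := _ ^+ n; lra.
have pow0 : (fun n => 2 * 2^-1 ^+ n : R) @ \oo --> (0 : R).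
  have := @cvg_geometric R 2 (2^-1).
  by apply; rewrite ger0_norm ?invr_ge0// invf_lt1// ltr1n.
have small (e : R) : 0 < e -> exists n, 2 * 2^-1 ^+ n <= e.
  move=> e0; have /cvgrPdist_le /(_ e e0) [N _ H] := pow0.
  exists N; have := H N (leqnn N); rewrite /= sub0r normrN.
  exact/le_trans/ler_norm.
have cu t : cvgn (fun n => u n t).
  apply/cauchy_cvgP/cauchy_exP => e e0.
  have [N HN] := small _ (divr_gt0 e0 (ltr0n _ 2)).
  exists (u N t); exists N => // n /= Nn; rewrite /ball /= distrC.
  have := duk N (n - N)%N t; rewrite subnKC// => /le_lt_trans; apply.
  by apply: le_lt_trans HN _; rewrite ltr_pdivrMr// ltr_pMr// ltr1n.
pose v t := limn (fun n => u n t).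
have uv n t : `|v t - u n t| <= 2 * 2^-1 ^+ n.
  have : (fun k => `|u k t - u n t|) @ \oo --> `|v t - u n t|.
    by apply: cvg_norm; apply: cvgB; [exact: cu|exact: cvg_cst].
  move=> h; apply: (cvgr_to_le h).
  by near=> k; have := duk n (k - n)%N t; rewrite subnKC//; near: k; exists n.
have vE : E v.
  apply: clE => e /small [n ne]; exists (u n); first by case: (uE n).
  by move=> t; apply: le_trans (uv _ _) ne.
have v1 t : `|v t| <= 1.
  apply: (cvgr_to_le (cvg_norm (cu t))); near=> n; exact: (uE n).2.
exists v; split => //; apply/funext => t.
apply/eqP; rewrite -subr_eq0 -normr_le0; apply/ler_addgt0Pr => e e0.
rewrite add0r.
have [n ne] := small e e0.
(* [u n.+1] is [F (u n)] by definition, and each of the two differences is at most 2^-n. *)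
have -> : F v t - v t = (F v t - F (u n) t) - (v t - u n.+1 t) by rewrite /=; ring.
apply: le_trans (ler_normB _ _) _.
have := Fc _ _ _ vE (uE n).1 v1 (uE n).2 (uv n) t.
have := uv n.+1 t; rewrite exprS mulrA mulfV// mul1r.
rewrite mulrC mulrA mulVf// mul1r.
move: ne; set x := _ ^+ n; set y := `|_|; set z := `|_|; lra.
Unshelve. all: end_near.
Qed.

(** For b u = 0 the eigenvalue equation reads (A - nu) u = delta (r (g0 + u) - Q (g0 + u)). The
    right side must lie in ker b, where G inverts A - nu; this forces r = b (Q (g0 + u)), and u
    becomes a fixed point of a map that contracts the unit ball for small delta. C and e are fixed
    before Q because the Q of the application depends on delta. *)
Lemma simple_eigenvalue_perturbation {R : realType} {T : Type}
    (E : set (T -> R)) (A G : (T -> R) -> (T -> R)) (b : (T -> R) -> R)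
    (g0 : T -> R) (nu K : R) :
  uniformly_closed E -> combination_closed E -> E g0 ->
  linear_on E A ->
  (forall f, E f -> E (G f)) -> linear_on E G ->
  (forall f (c : R), E f -> (forall t, `|f t| <= c) -> forall t, `|G f t| <= K * c) ->
  linear_on E (b : _ -> R^o) ->
  (forall f (c : R), E f -> (forall t, `|f t| <= c) -> `|b f| <= K * c) ->
  0 <= K -> (forall t, `|g0 t| <= K) ->
  A g0 = nu *: g0 -> b g0 = 1 ->
  (forall f, E f -> b f = 0 -> b (G f) = 0 /\ A (G f) = nu *: G f + f) ->
  exists C e : R, 0 < e /\
    forall (Q : (T -> R) -> (T -> R)) (delta : R),
      (forall f, E f -> E (Q f)) -> linear_on E Q ->
      (forall f (c : R), E f -> (forall t, `|f t| <= c) ->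
         forall t, `|Q f t| <= K * c) ->
      `|delta| <= e ->
      exists (u : T -> R) (r : R), [/\ E u, b u = 0,
        forall t, `|u t| <= C * `|delta|, `|r| <= C &
        A (g0 + u) + delta *: Q (g0 + u) = (nu + delta * r) *: (g0 + u)].
Proof.
move=> clE linE Eg0 linA GE linG bG linb bb K0 bg0 Ag0 bg01 Gb.
(* On the unit ball L bounds g0 + u, C1 bounds the map [h] below and D is a Lipschitz constant of
   it; C dominates r and the ratio of u to delta. *)
pose L := K + 1.
pose C1 := K ^+ 2 * L + K * L + K ^+ 3 * L.
pose D := K ^+ 2 + K ^+ 2 * L + K + K ^+ 3.
pose C := K * C1 + K ^+ 2 * L.
have L0 : 0 <= L by rewrite addr_ge0.
have C10 : 0 <= C1 by rewrite /C1 !addr_ge0// !mulr_ge0// exprn_ge0.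
have D0 : 0 <= D by rewrite /D !addr_ge0// ?mulr_ge0// exprn_ge0.
have C0 : 0 <= C by rewrite /C !addr_ge0// ?mulr_ge0// exprn_ge0.
have E0 : E 0.
  by have := linE (-1) g0 g0 Eg0 Eg0; rewrite scaleN1r addNr.
have ED := combination_closedD E linE.
have EZ := combination_closedZ E linE E0.
have EB f g : E f -> E g -> E (f - g).
  by move=> Ef Eg; apply/ED => //; rewrite -scaleN1r; exact: EZ.
have lD V M := linear_onD E V M.
have lZ V M := linear_onZ E E0 V M.
have lB V M := linear_onB E linE E0 V M.
exists C, (2 * (C + K * D + 1))^-1; split.
  by rewrite invr_gt0 mulr_gt0// ltr_pwDr// addr_ge0// mulr_ge0.
move=> Q delta QE linQ bQ dle.
have dC : `|delta| * (K * C1) <= 1.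
  apply: le_trans (ler_pM _ _ dle (lexx _)) _ => //; first by rewrite mulr_ge0.
  rewrite mulrC ler_pdivrMr; last first.
    by rewrite mulr_gt0// ltr_pwDr// addr_ge0// mulr_ge0.
  have : 0 <= K * D by rewrite mulr_ge0.
  have : 0 <= K ^+ 2 * L by rewrite mulr_ge0// exprn_ge0.
  have : 0 <= K * C1 by rewrite mulr_ge0.
  by rewrite /C; lra.
have dD : `|delta| * (K * D) <= 2^-1.
  apply: le_trans (ler_pM _ _ dle (lexx _)) _ => //; first by rewrite mulr_ge0.
  rewrite mulrC ler_pdivrMr; last first.
    by rewrite mulr_gt0// ltr_pwDr// addr_ge0// mulr_ge0.
  have : 0 <= K * D by rewrite mulr_ge0.
  have : 0 <= C by [].
  lra.
pose r u := b (Q (g0 + u)).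
pose h u := r u *: u - Q (g0 + u) + r u *: g0.
pose F u := delta *: G (h u).
pose E' := [set u | E u /\ b u = 0].
have Eh u : E u -> E (h u).
  move=> Eu; apply/ED; last exact: EZ.
  by apply/EB; [exact: EZ|by apply/QE; exact: ED].
have bh u : E u -> b u = 0 -> b (h u) = 0.
  move=> Eu bu; have EQ := QE _ (ED _ _ Eg0 Eu).
  rewrite /h (lD R^o b)//; [|by apply/EB => //; exact: EZ|exact: EZ].
  rewrite (lB R^o b)//; last exact: EZ.
  rewrite !(lZ R^o b)// bu bg01 scaler0 -/(r u) sub0r.
  by rewrite /GRing.scale /= mulr1 addNr.
have bf u : (forall t, `|u t| <= 1) -> forall t, `|(g0 + u) t| <= L.
  by move=> u1 t; apply: le_trans (ler_normD _ _) _; apply: lerD.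
have br u : E u -> (forall t, `|u t| <= 1) -> `|r u| <= K ^+ 2 * L.
  move=> Eu u1; rewrite expr2 -mulrA; apply/bb; first by apply/QE; exact: ED.
  by apply/bQ; [exact: ED|exact: bf].
have bh1 u : E u -> (forall t, `|u t| <= 1) -> forall t, `|h u t| <= C1.
  move=> Eu u1 t; rewrite /h /C1.
  apply: le_trans (ler_normD _ _) _; apply: lerD.
    apply: le_trans (ler_normB _ _) _; apply: lerD.
      rewrite [X in `|X|]/(_ *: _) /= normrM -[leRHS]mulr1.
      by apply: ler_pM => //; exact: br.
    by apply/bQ; [exact: ED|exact: bf].
  rewrite [X in `|X|]/(_ *: _) /= normrM (_ : K ^+ 3 * L = K ^+ 2 * L * K); last by ring.
  by apply: ler_pM => //; exact: br.
have bF u : E u -> (forall t, `|u t| <= 1) ->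
    forall t, `|F u t| <= `|delta| * (K * C1).
  move=> Eu u1 t; rewrite /F [X in `|X|]/(_ *: _) /= normrM ler_wpM2l//.
  by apply/bG; [exact: Eh|exact: bh1].
have [u [[Eu bu] u1 Fu]] : exists u, [/\ E' u, forall t, `|u t| <= 1 & F u = u].
  apply: sup_norm_fixed_point.
  - move=> f fE; have Ef : E f.
      by apply: clE => e /fE [g [Eg _] ?]; exists g.
    split => //.
    apply/eqP; rewrite -normr_le0; apply/ler_addgt0Pr => e e0; rewrite add0r.
    have e1 : 0 < e / (K + 1) by rewrite divr_gt0// ltr_wpDl.
    have [g [Eg bg0'] fg] := fE _ e1.
    have -> : b f = b (f - g) by rewrite (lB R^o b)// bg0' subr0.
    apply: le_trans (bb _ _ (EB _ _ Ef Eg) fg) _.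
    rewrite mulrCA ler_piMr ?(ltW e0)// ler_pdivrMr; last by rewrite ltr_wpDl.
    by rewrite mul1r lerDl.
  - split => //; exact: (linear_on0 E E0 R^o b).
  - move=> u [Eu bu] u1; split; last first.
      by move=> t; apply: le_trans (bF _ Eu u1 t) dC.
    split; first exact/EZ/GE/Eh.
    rewrite /F (lZ R^o b)//; last exact/GE/Eh.
    by rewrite (Gb _ (Eh _ Eu) (bh _ Eu bu)).1 scaler0.
  - move=> u v c [Eu _] [Ev _] u1 v1 uv t.
    have Euv := EB _ _ Eu Ev.
    have -> : F u t - F v t = delta * G (h u - h v) t.
      by rewrite (lB _ G)//; [rewrite /F mulrBr|exact: Eh|exact: Eh].
    have Q_uv : Q (g0 + u) - Q (g0 + v) = Q (u - v).
      rewrite -(lB _ Q)//; [|exact: ED|exact: ED].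
      by congr Q; rewrite opprD addrACA subrr add0r.
    have r_uv : r u - r v = b (Q (u - v)).
      by rewrite /r -Q_uv (lB R^o b)//; by apply/QE; exact: ED.
    have c0 : 0 <= c by apply: le_trans (uv t).
    have bQuv : forall s, `|Q (u - v) s| <= K * c by apply/bQ.
    have bruv : `|r u - r v| <= K ^+ 2 * c.
      by rewrite r_uv expr2 -mulrA; apply/bb => //; exact: QE.
    have bhuv s : `|(h u - h v) s| <= D * c.
      have -> : (h u - h v) s = (r u - r v) * u s + r v * (u s - v s)
          - Q (u - v) s + (r u - r v) * g0 s.
        rewrite -Q_uv /h.
        rewrite -[LHS]/((r u * u s - Q (g0 + u) s + r u * g0 s) -
          (r v * v s - Q (g0 + v) s + r v * g0 s)).
        rewrite -[(Q (g0 + u) - Q (g0 + v)) s]/(Q (g0 + u) s - Q (g0 + v) s).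
        by ring.
      have -> : D * c = K ^+ 2 * c + K ^+ 2 * L * c + K * c + K ^+ 3 * c.
        by rewrite /D; ring.
      apply: le_trans (ler_normD _ _) _; apply: lerD; last first.
        rewrite normrM (_ : K ^+ 3 * c = K ^+ 2 * c * K); last by ring.
        exact: ler_pM.
      apply: le_trans (ler_normB _ _) _; apply: lerD => //.
      apply: le_trans (ler_normD _ _) _; apply: lerD.
        by rewrite normrM -[leRHS]mulr1; apply: ler_pM.
      by rewrite normrM; apply: ler_pM => //; exact: br.
    rewrite normrM.
    apply: le_trans (ler_wpM2l (normr_ge0 _) (bG _ _ _ bhuv t)) _.
      by apply/EB; exact: Eh.
    rewrite (_ : _ * _ = `|delta| * (K * D) * c); last by ring.
    by rewrite (mulrC c) ler_wpM2r.
exists u, (r u); split => //.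
- move=> t; rewrite -{1}Fu mulrC.
  apply: le_trans (bF _ Eu u1 t) _; rewrite ler_wpM2l// /C lerDl.
  by rewrite mulr_ge0// exprn_ge0.
- by apply: le_trans (br _ Eu u1) _; rewrite /C lerDr mulr_ge0.
- have Au : A u = nu *: u + delta *: h u.
    rewrite -{1}Fu /F (lZ _ A)//; last exact/GE/Eh.
    rewrite (Gb _ (Eh _ Eu) (bh _ Eu bu)).2 scalerDr; congr (_ + _).
    by rewrite scalerA mulrC -scalerA -/(F u) Fu.
  rewrite (lD _ A)// Ag0 Au /h; apply/funext => t.
  set q := Q _.
  rewrite -[LHS]/(nu * g0 t + (nu * u t +
    delta * (r u * u t - q t + r u * g0 t)) + delta * q t).
  rewrite -[RHS]/((nu + delta * r u) * (g0 t + u t)).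
  by ring.
Qed.

(** * Functions approximated uniformly by sine polynomials *)

Definition int_period {R : realType} (f : R -> R) : R :=
  \int[lebesgue_measure]_(x in `[0, 2 * pi]) f x.

Section int_period.
Context {R : realType}.
Implicit Types f g : R -> R.

Lemma continuous_const (c : R) : continuous (fun _ : R => c).
Proof. by move=> x; exact: cvg_cst. Qed.

Lemma twopi_gt0 : 0 < 2 * pi :> R.
Proof. by rewrite mulr_gt0// pi_gt0. Qed.

Lemma int_period_integrable f : continuous f ->
  lebesgue_measure.-integrable `[0, 2 * pi] (EFin \o f).
Proof.
move=> cf; apply: continuous_compact_integrable; first exact: segment_compact.
exact: continuous_subspaceT.
Qed.

Lemma int_periodD f g : continuous f -> continuous g ->
  int_period (fun x => f x + g x) = int_period f + int_period g.
Proof.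
by move=> cf cg; apply: RintegralD => //; exact: int_period_integrable.
Qed.

Lemma int_periodZ (a : R) f : continuous f ->
  int_period (fun x => a * f x) = a * int_period f.
Proof.
by move=> cf; apply: RintegralZl => //; exact: int_period_integrable.
Qed.

Lemma int_period0 : int_period (fun=> 0 : R) = 0.
Proof.
rewrite -[RHS](mul0r (int_period (fun=> 0 : R))) -int_periodZ; last first.
  by exact: continuous_const.
by congr int_period; apply/funext => x; rewrite mul0r.
Qed.

Lemma continuous_sum_fun (I : Type) (s : seq I) (F : I -> R -> R) :
  (forall i, continuous (F i)) -> continuous (fun x => \sum_(i <- s) F i x).
Proof.
move=> cF; elim: s => [|i s IH].
  have -> : (fun x : R => \sum_(i <- [::]) F i x) = fun=> 0.
    by apply/funext => x; rewrite big_nil.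
  by exact: continuous_const.
have -> : (fun x => \sum_(j <- i :: s) F j x) =
    (fun x => F i x + \sum_(j <- s) F j x).
  by apply/funext => x; rewrite big_cons.
by move=> x; apply: cvgD; [exact: cF|exact: IH].
Qed.

Lemma int_period_sum (I : Type) (s : seq I) (F : I -> R -> R) :
  (forall i, continuous (F i)) ->
  int_period (fun x => \sum_(i <- s) F i x) = \sum_(i <- s) int_period (F i).
Proof.
move=> cF; elim: s => [|i s IH].
  rewrite big_nil -[RHS]int_period0; congr int_period.
  by apply/funext => x; rewrite big_nil.
rewrite big_cons -IH -int_periodD//; last exact: continuous_sum_fun.
by congr int_period; apply/funext => x; rewrite big_cons.
Qed.

Lemma int_period_cst (c : R) : int_period (fun=> c) = c * (2 * pi).
Proof.
rewrite /int_period Rintegral_cst//; congr (_ * _).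
rewrite -[RHS]/(fine (2 * pi)%:E); congr fine.
apply: etrans (lebesgue_measure_itv `[0, 2 * pi]) _.
by rewrite /= lte_fin twopi_gt0 sube0.
Qed.

Lemma int_period_le f (M : R) : continuous f -> (forall x, `|f x| <= M) ->
  `|int_period f| <= 2 * pi * M.
Proof.
move=> cf fM.
have cM : continuous (fun _ : R => M) by exact: continuous_const.
have ca : continuous (fun x => `|f x|).
  by move=> x; apply: cvg_norm; exact: cf.
apply: le_trans (le_normr_Rintegral _ (int_period_integrable _ cf)) _ => //.
apply: (@le_trans _ _ (int_period (fun=> M))).
  by apply: le_Rintegral => //; exact: int_period_integrable.
by rewrite int_period_cst mulrC.
Qed.

Lemma int_period_FTC f (F : R -> R) : continuous f ->
  (forall x : R, is_derive x 1 F (f x)) ->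
  int_period f = F (2 * pi) - F 0.
Proof.
move=> cf dF; rewrite /int_period /Rintegral.
have cF : continuous F.
  move=> x; apply: differentiable_continuous; apply/derivable1_diffP.
  by have [] := dF x.
rewrite (@continuous_FTC2 R f F 0 (2 * pi))//.
- exact: twopi_gt0.
- exact: continuous_subspaceT.
- split.
  + by move=> x _; have [] := dF x.
  + exact/cvg_at_right_filter/cF.
  + exact/cvg_at_left_filter/cF.
- by move=> x _; rewrite derive1E; have [_ ->] := dF x.
Qed.

Lemma continuous_mul_cst (c : R) : continuous (fun x : R => c * x).
Proof. by move=> x; apply: cvgM; [exact: cvg_cst|exact: cvg_id]. Qed.

Lemma continuous_cosM (c : R) : continuous (fun x : R => cos (c * x)).
Proof.
move=> x; apply: (continuous_comp (continuous_mul_cst c x)).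
exact: continuous_cos.
Qed.

Lemma continuous_sinM (c : R) : continuous (fun x : R => sin (c * x)).
Proof.
move=> x; apply: (continuous_comp (continuous_mul_cst c x)).
exact: continuous_sin.
Qed.

Lemma continuous_mul f g : continuous f -> continuous g ->
  continuous (fun x => f x * g x).
Proof. by move=> cf cg x; apply: cvgM; [exact: cf|exact: cg]. Qed.

Lemma continuous_add f g : continuous f -> continuous g ->
  continuous (fun x => f x + g x).
Proof. by move=> cf cg x; apply: cvgD; [exact: cf|exact: cg]. Qed.

Lemma int_period_cosM (c : R) : c != 0 -> sin (c * (2 * pi)) = 0 ->
  int_period (fun x => cos (c * x)) = 0.
Proof.
move=> c0 s0.
have dF (x : R) : is_derive x 1 (fun x : R => c^-1 * sin (c * x)) (cos (c * x)).
  apply: is_derive_eq.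
  by rewrite ?scaler0 ?addr0 /= /GRing.scale /= ?mulr1; field.
rewrite (int_period_FTC _ _ (continuous_cosM c) dF).
by rewrite s0 !mulr0 sin0 mulr0 subr0.
Qed.

Lemma int_period_sinM (c : R) : cos (c * (2 * pi)) = 1 ->
  int_period (fun x => sin (c * x)) = 0.
Proof.
move=> s0; have [->|c0] := eqVneq c 0.
  rewrite -[RHS]int_period0; congr int_period; apply/funext => x.
  by rewrite mul0r sin0.
have dF (x : R) : is_derive x 1 (fun x : R => - c^-1 * cos (c * x)) (sin (c * x)).
  apply: is_derive_eq.
  by rewrite ?scaler0 ?addr0 /= /GRing.scale /= ?mulr1; field.
rewrite (int_period_FTC _ _ (continuous_sinM c) dF).
by rewrite s0 !mulr0 cos0 subrr.
Qed.

Lemma cos_nat2pi n : cos (n%:R * (2 * pi)) = 1 :> R.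
Proof.
elim: n => [|n IH]; first by rewrite mul0r cos0.
have e : 2 * pi = pi *+ 2 :> R by rewrite mulr2n; ring.
by move: IH; rewrite e -[n.+1%:R]natr1 mulrDl mul1r cosD2pi.
Qed.

Lemma sin_nat2pi n : sin (n%:R * (2 * pi)) = 0 :> R.
Proof.
elim: n => [|n IH]; first by rewrite mul0r sin0.
have e : 2 * pi = pi *+ 2 :> R by rewrite mulr2n; ring.
by move: IH; rewrite e -[n.+1%:R]natr1 mulrDl mul1r sinD2pi.
Qed.

Lemma int_period_cos_sin p q :
  int_period (fun x => cos (p%:R * x) * sin (q%:R * x)) = 0 :> R.
Proof.
have -> : (fun x : R => cos (p%:R * x) * sin (q%:R * x)) =
    fun x => 2^-1 * sin ((q + p)%:R * x) + 2^-1 * sin ((q%:R - p%:R) * x).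
  by apply/funext => x; rewrite natrD mulrDl sinD mulrBl sinB; field.
rewrite int_periodD; last 2 first.
- by apply: continuous_mul; [exact: continuous_const|exact: continuous_sinM].
- by apply: continuous_mul; [exact: continuous_const|exact: continuous_sinM].
rewrite !int_periodZ; [|exact: continuous_sinM|exact: continuous_sinM].
rewrite !int_period_sinM ?mulr0 ?addr0//; last exact: cos_nat2pi.
by rewrite mulrBl cosB !cos_nat2pi !sin_nat2pi mulr0 addr0 mulr1.
Qed.

Lemma int_period_sin_sin p q : (0 < p)%N ->
  int_period (fun x => sin (p%:R * x) * sin (q%:R * x)) =
  (p == q)%:R * pi :> R.
Proof.
move=> p0.
have -> : (fun x : R => sin (p%:R * x) * sin (q%:R * x)) =
    fun x => - 2^-1 * cos ((p + q)%:R * x) + 2^-1 * cos ((p%:R - q%:R) * x).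
  by apply/funext => x; rewrite natrD mulrDl cosD mulrBl cosB; field.
rewrite int_periodD; last 2 first.
- by apply: continuous_mul; [exact: continuous_const|exact: continuous_cosM].
- by apply: continuous_mul; [exact: continuous_const|exact: continuous_cosM].
rewrite !int_periodZ; [|exact: continuous_cosM|exact: continuous_cosM].
rewrite int_period_cosM ?sin_nat2pi//; last first.
  by rewrite pnatr_eq0 addn_eq0 -leqn0 leqNgt p0.
rewrite mulr0 add0r; have [->|pq] := eqVneq p q.
  have -> : (fun x : R => cos ((q%:R - q%:R) * x)) = fun=> 1.
    by apply/funext => x; rewrite subrr mul0r cos0.
  by rewrite int_period_cst mul1r [RHS]mul1r mulrA mulVf// mul1r.
rewrite int_period_cosM ?mulr0 ?mul0r//; last first.
  by rewrite mulrBl sinB !cos_nat2pi !sin_nat2pi !mulr0 !mul0r subrr.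
by rewrite subr_eq0 eqr_nat.
Qed.

End int_period.

(** A space of continuous bounded functions, suited to sup-norm estimates, whose product with J^-1
    lies in [Vs] ([Vs_invJ]). *)
Definition sine_closure {R : realType} : set (R -> R) :=
  [set f | forall e : R, 0 < e -> exists (N : nat) (c : nat -> R),
     forall t, `|f t - \sum_(1 <= n < N.+1) c n * sin (n%:R * t)| <= e].

Section sine_closure.
Context {R : realType}.
Local Notation E := (@sine_closure R).

Lemma sine_closure_uniformly_closed : uniformly_closed E.
Proof.
move=> f H e e0; have [g Eg fg] := H _ (divr_gt0 e0 (ltr0n _ 2)).
have [N [c Hc]] := Eg _ (divr_gt0 e0 (ltr0n _ 2)).
exists N, c => t.
rewrite (_ : _ - _ = f t - g t +
  (g t - \sum_(1 <= n < N.+1) c n * sin (n%:R * t))); last by ring.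
apply: le_trans (ler_normD _ _) _.
by apply: le_trans (lerD (fg t) (Hc t)) _; lra.
Qed.

Lemma sine_sum_widen (N M : nat) (c : nat -> R) t : (N <= M)%N ->
  \sum_(1 <= n < N.+1) c n * sin (n%:R * t) =
  \sum_(1 <= n < M.+1) (if (n <= N)%N then c n else 0) * sin (n%:R * t).
Proof.
move=> NM; rewrite [RHS](big_cat_nat (n := N.+1))//=.
rewrite [X in _ = _ + X]big_nat_cond [X in _ = _ + X]big1 ?addr0; last first.
  by move=> n /andP[/andP[Nn _] _]; rewrite leqNgt Nn mul0r.
by apply: eq_big_nat => n /andP[_]; rewrite ltnS => ->.
Qed.

Lemma sine_closure_linear : combination_closed E.
Proof.
move=> a f g Ef Eg e e0.
have d0 : 0 < e / (2 * (`|a| + 1)) by rewrite divr_gt0// mulr_gt0// ltr_wpDl.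
have [N [c Hc]] := Ef _ d0.
have [M [b Hb]] := Eg _ (divr_gt0 e0 (ltr0n _ 2)).
exists (maxn N M), (fun n => a * (if (n <= N)%N then c n else 0)
  + (if (n <= M)%N then b n else 0)) => t.
under eq_bigr do rewrite mulrDl -mulrA.
rewrite big_split /= -mulr_sumr -!sine_sum_widen ?leq_maxl ?leq_maxr//.
set x := \sum_(_ <= _ < _) _; set y := \sum_(_ <= _ < _) _.
rewrite -[(a *: f + g) t]/(a * f t + g t).
rewrite (_ : _ - _ = a * (f t - x) + (g t - y)); last by ring.
apply: le_trans (ler_normD _ _) _.
have h : `|a * (f t - x)| <= e / 2.
  rewrite normrM; apply: le_trans (ler_wpM2l (normr_ge0 a) (Hc t)) _.
  rewrite mulrA ler_pdivrMr ?mulr_gt0 ?ltr_wpDl//.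
  by rewrite (_ : e / 2 * _ = `|a| * e + e) ?lerDl ?ltW//; field.
by apply: le_trans (lerD h (Hb t)) _; lra.
Qed.

Lemma sine_closure_sin n : E (fun t => sin (n%:R * t)).
Proof.
move=> e e0; case: n => [|n].
  exists 0%N, (fun=> 0) => t; rewrite mul0r sin0 big_geq// subrr normr0; exact: ltW.
exists n.+1, (fun k => (k == n.+1)%:R) => t.
rewrite big_nat_recr//= eqxx mul1r big_nat_cond big1 ?add0r ?subrr ?normr0 ?ltW//.
by move=> i /andP[/andP[_ iN] _]; rewrite ltn_eqF// mul0r.
Qed.

Lemma sine_closure0 : E (fun=> 0).
Proof.
have := sine_closure_linear (-1) _ _ (sine_closure_sin 0) (sine_closure_sin 0).
by rewrite scaleN1r addNr; exact.
Qed.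

Lemma sine_closureZ (a : R) f : E f -> E (fun t => a * f t).
Proof.
move=> Ef; have := sine_closure_linear a _ _ Ef sine_closure0.
rewrite (_ : _ + _ = fun t => a * f t)//; apply/funext => t.
by rewrite -[LHS]/(a * f t + 0) addr0.
Qed.

Lemma sine_closureD f g : E f -> E g -> E (fun t => f t + g t).
Proof.
move=> Ef Eg; have := sine_closure_linear 1 _ _ Ef Eg.
rewrite (_ : _ + _ = fun t => f t + g t)//; apply/funext => t.
by rewrite -[LHS]/(1 * f t + g t) mul1r.
Qed.

Lemma continuous_sine_sum (N : nat) (c : nat -> R) :
  continuous (fun t : R => \sum_(1 <= n < N.+1) c n * sin (n%:R * t)).
Proof.
apply: continuous_sum_fun => n; apply: continuous_mul.
  by exact: continuous_const.
exact: continuous_sinM.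
Qed.

Lemma sine_closure_continuous f : E f -> continuous f.
Proof.
move=> Ef x; apply/cvgrPdist_le => e e0.
have [N [c Hc]] := Ef _ (divr_gt0 e0 (ltr0n _ 3)).
have /cvgrPdist_le /(_ _ (divr_gt0 e0 (ltr0n _ 3))) H :=
  continuous_sine_sum N c x.
near=> y.
have := Hc x; have := Hc y.
have : `|\sum_(1 <= n < N.+1) c n * sin (n%:R * x) -
   \sum_(1 <= n < N.+1) c n * sin (n%:R * y)| <= e / 3 by near: y.
set X := \sum_(1 <= n < N.+1) _; set Y := \sum_(1 <= n < N.+1) _ => h1 h2 h3.
have -> : f x - f y = (f x - X) + (X - Y) - (f y - Y) by ring.
apply: le_trans (ler_normB _ _) _.
apply: le_trans (lerD (ler_normD _ _) (lexx _)) _.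
by apply: le_trans (lerD (lerD h3 h1) h2) _; lra.
Unshelve. all: end_near.
Qed.

Lemma sine_closure_bounded f : E f -> exists c, forall x, `|f x| <= c.
Proof.
move=> Ef; have [N [c Hc]] := Ef _ (@ltr01 R).
exists (1 + \sum_(1 <= n < N.+1) `|c n|) => x.
rewrite (_ : f x = (f x - \sum_(1 <= n < N.+1) c n * sin (n%:R * x)) +
   \sum_(1 <= n < N.+1) c n * sin (n%:R * x)); last by rewrite subrK.
apply: le_trans (ler_normD _ _) _; apply: lerD => //.
apply: le_trans (ler_norm_sum _ _ _) _; apply: ler_sum => n _.
by rewrite normrM -[leRHS]mulr1 ler_pM// ler_norml sin_le1 sin_geN1.
Qed.

(** Sines and cosines of integer frequency are orthogonal over a period, and uniform approximation
    extends this to the closure. At q = 0 it removes the constant part of the kernel; in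
    [kernel_op_wave] it removes the cosine half of each exponential. *)
Lemma sine_closure_orthogonal f q : E f ->
  int_period (fun x => cos (q%:R * x) * f x) = 0.
Proof.
move=> Ef; apply/eqP; rewrite -normr_le0; apply/ler_addgt0Pr => e e0.
rewrite add0r.
have cf := sine_closure_continuous _ Ef.
have [N [c Hc]] := Ef _ (divr_gt0 e0 (@twopi_gt0 R)).
pose g t := \sum_(1 <= n < N.+1) c n * sin (n%:R * t).
have cg : continuous g by exact: continuous_sine_sum.
(* Subtracting the approximating sine polynomial leaves the integral unchanged and makes the
   integrand small. *)
have -> : int_period (fun x => cos (q%:R * x) * f x) =
    int_period (fun x => cos (q%:R * x) * (f x - g x)).
  have -> : (fun x => cos (q%:R * x) * f x) =
    (fun x => cos (q%:R * x) * (f x - g x) + \sum_(1 <= n < N.+1)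
        c n * (cos (q%:R * x) * sin (n%:R * x))).
    apply/funext => x.
    rewrite (_ : \sum_(1 <= n < N.+1) _ = cos (q%:R * x) * g x).
      by rewrite -mulrDr subrK.
    by rewrite /g mulr_sumr; apply: eq_bigr => n _; ring.
  have cs (n : nat) : continuous (fun x : R => cos (q%:R * x) * sin (n%:R * x) : R).
    by apply: continuous_mul; [exact: continuous_cosM|exact: continuous_sinM].
  have cc (n : nat) : continuous (fun x : R => c n * (cos (q%:R * x) * sin (n%:R * x)) : R).
    by apply: continuous_mul => //; exact: continuous_const.
  rewrite int_periodD.
  - rewrite int_period_sum// big1 ?addr0// => n _.
    by rewrite int_periodZ// int_period_cos_sin mulr0.
  - apply: continuous_mul; first exact: continuous_cosM.
    by move=> x; apply: cvgB; [exact: cf|exact: cg].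
  - exact: continuous_sum_fun.
apply: (@le_trans _ _ (2 * pi * (e / (2 * pi)))).
  apply: int_period_le.
    apply: continuous_mul; first exact: continuous_cosM.
    by move=> x; apply: cvgB; [exact: cf|exact: cg].
  move=> x; rewrite normrM -[leRHS]mul1r ler_pM//.
  by rewrite ler_norml cos_le1 cos_geN1.
by rewrite mulrC divfK// gt_eqF// twopi_gt0.
Qed.

End sine_closure.

(** * Integral operators preserving sine series *)

Section complex_facts.
Context {R : realType}.
Implicit Types z w : R[i].

Lemma Re_add z w : complex.Re (z + w) = complex.Re z + complex.Re w.
Proof. by case: z; case: w. Qed.

Lemma Re_scale (a : R) z : complex.Re (a%:C * z) = a * complex.Re z.
Proof. by case: z => x y /=; rewrite mul0r subr0. Qed.

Lemma Re_sum (I : Type) (s : seq I) (F : I -> R[i]) :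
  complex.Re (\sum_(i <- s) F i) = \sum_(i <- s) complex.Re (F i).
Proof. exact: (big_morph _ Re_add). Qed.

Lemma Im_sum (I : Type) (s : seq I) (F : I -> R[i]) :
  complex.Im (\sum_(i <- s) F i) = \sum_(i <- s) complex.Im (F i).
Proof. by apply: (big_morph _ _) => // -[? ?] [? ?]. Qed.

Lemma expiD (x y : R) : expi (x + y) = expi x * expi y.
Proof.
by apply/eqP; rewrite eq_complex /= cosD sinD eqxx /=; apply/eqP; ring.
Qed.

Lemma expi0 : expi (0 : R) = 1.
Proof. by rewrite /expi cos0 sin0. Qed.

Lemma normc_expi (x : R) : normc (expi x) = 1.
Proof. by rewrite /= cos2Dsin2 sqrtr1. Qed.

Lemma normc_real (a : R) : normc a%:C = `|a|.
Proof. by rewrite /= expr0n addr0 sqrtr_sqr. Qed.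

Lemma normc_ge0 z : 0 <= normc z.
Proof. by case: z => x y /=; exact: sqrtr_ge0. Qed.

Lemma Re_le_normc z : `|complex.Re z| <= normc z.
Proof.
case: z => x y /=; rewrite -sqrtr_sqr ler_wsqrtr// lerDl; exact: sqr_ge0.
Qed.

Lemma normc_sum (I : Type) (s : seq I) (F : I -> R[i]) :
  normc (\sum_(i <- s) F i) <= \sum_(i <- s) normc (F i).
Proof.
elim: s => [|i s IH]; first by rewrite !big_nil normc0.
by rewrite !big_cons; apply: le_trans (le_normcD _ _) _; rewrite lerD2l.
Qed.

Lemma normcX z n : normc (z ^+ n) = normc z ^+ n.
Proof.
by elim: n => [|n IH]; rewrite ?expr0 ?normc1// !exprS normcM IH.
Qed.

Definition continuousC (h : R -> R[i]) :=
  continuous (fun x => complex.Re (h x)) /\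
  continuous (fun x => complex.Im (h x)).

Lemma continuousC_cst z : continuousC (fun=> z).
Proof. by split; exact: continuous_const. Qed.

Lemma continuousC_add h k : continuousC h -> continuousC k ->
  continuousC (fun x => h x + k x).
Proof.
move=> [h1 h2] [k1 k2]; split.
  rewrite (_ : (fun _ => _) = fun x => complex.Re (h x) + complex.Re (k x)).
    exact: continuous_add.
  by apply/funext => x; case: (h x); case: (k x).
rewrite (_ : (fun _ => _) = fun x => complex.Im (h x) + complex.Im (k x)).
  exact: continuous_add.
by apply/funext => x; case: (h x); case: (k x).
Qed.

Lemma continuousC_mul h k : continuousC h -> continuousC k ->
  continuousC (fun x => h x * k x).
Proof.
move=> [h1 h2] [k1 k2]; split.
  rewrite (_ : (fun _ => _) = fun x => complex.Re (h x) * complex.Re (k x)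
      + (-1) * (complex.Im (h x) * complex.Im (k x))).
    apply: continuous_add; first exact: continuous_mul.
    by apply: continuous_mul; [exact: continuous_const|exact: continuous_mul].
  by apply/funext => x; case: (h x); case: (k x) => ? ? ? ? /=; ring.
rewrite (_ : (fun _ => _) = fun x => complex.Re (h x) * complex.Im (k x)
    + complex.Im (h x) * complex.Re (k x)).
  by apply: continuous_add; exact: continuous_mul.
by apply/funext => x; case: (h x); case: (k x) => ? ? ? ? /=; ring.
Qed.

Lemma continuousC_sum (I : Type) (s : seq I) (F : I -> R -> R[i]) :
  (forall i, continuousC (F i)) -> continuousC (fun x => \sum_(i <- s) F i x).
Proof.
move=> cF; split.
  rewrite (_ : (fun _ => _) = fun x => \sum_(i <- s) complex.Re (F i x)).
    by apply: continuous_sum_fun => i; exact: (cF i).1.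
  by apply/funext => x; exact: Re_sum.
rewrite (_ : (fun _ => _) = fun x => \sum_(i <- s) complex.Im (F i x)).
  by apply: continuous_sum_fun => i; exact: (cF i).2.
by apply/funext => x; exact: Im_sum.
Qed.

Lemma continuousC_inv h : continuousC h -> (forall x, h x != 0) ->
  continuousC (fun x => (h x)^-1).
Proof.
move=> [h1 h2] h0.
have n0 x : complex.Re (h x) * complex.Re (h x) + complex.Im (h x) * complex.Im (h x) != 0.
  have := h0 x; apply: contraNneq => /eqP.
  case: (h x) => a b /=; rewrite -!expr2 paddr_eq0 ?sqr_ge0// !expf_eq0/=.
  by move=> /andP[/eqP -> /eqP ->].
have cn : continuous (fun x => (complex.Re (h x) * complex.Re (h x) +
    complex.Im (h x) * complex.Im (h x))^-1).
  move=> x; apply: cvgV; first exact: n0.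
  exact: (continuous_add _ _ (continuous_mul _ _ h1 h1)
    (continuous_mul _ _ h2 h2)).
split.
  rewrite (_ : (fun _ => _) = fun x => complex.Re (h x) * (complex.Re (h x) *
    complex.Re (h x) + complex.Im (h x) * complex.Im (h x))^-1).
    exact: continuous_mul.
  by apply/funext => x; rewrite -!expr2; case: (h x).
rewrite (_ : (fun _ => _) = fun x => (-1) * complex.Im (h x) * (complex.Re (h x)
  * complex.Re (h x) + complex.Im (h x) * complex.Im (h x))^-1).
  apply: continuous_mul => //; apply: continuous_mul => //.
  exact: continuous_const.
by apply/funext => x; rewrite -!expr2 mulN1r; case: (h x) => ? ? /=; rewrite ?mulNr.
Qed.

Lemma continuousC_expi (a b : R) : continuousC (fun x => expi (- (a + b * x))).
Proof.
have c x : continuous_at x (fun x : R => - (a + b * x)).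
  by apply: cvgN; apply: cvgD; [exact: cvg_cst|exact: continuous_mul_cst].
by split=> x; apply: (continuous_comp (c x)); [exact: continuous_cos|exact: continuous_sin].
Qed.

End complex_facts.

Definition kernel_op {R : realType} (H : R -> R -> R[i]) (f : R -> R) (t : R) : R :=
  (2 * pi)^-1 * int_period (fun x => complex.Re (H t x) * f x).

Section kernel_op.
Context {R : realType}.
Implicit Types (H : R -> R -> R[i]) (f : R -> R).
Local Notation E := (@sine_closure R).

Lemma kernel_opD H1 H2 f :
  (forall t, continuousC (H1 t)) -> (forall t, continuousC (H2 t)) ->
  continuous f ->
  kernel_op (fun t x => H1 t x + H2 t x) f =
  fun t => kernel_op H1 f t + kernel_op H2 f t.
Proof.
move=> c1 c2 cf; apply/funext => t; rewrite /kernel_op -mulrDr.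
rewrite -int_periodD; last 2 first.
- by apply: continuous_mul => //; exact: (c1 t).1.
- by apply: continuous_mul => //; exact: (c2 t).1.
by congr (_ * _); congr int_period; apply/funext => x; rewrite Re_add mulrDl.
Qed.

Lemma kernel_opZ (a : R) H f : (forall t, continuousC (H t)) -> continuous f ->
  kernel_op (fun t x => a%:C * H t x) f = fun t => a * kernel_op H f t.
Proof.
move=> cH cf; apply/funext => t; rewrite /kernel_op mulrCA -(int_periodZ a).
  by congr (_ * _); congr int_period; apply/funext => x; rewrite Re_scale mulrA.
by apply: continuous_mul => //; exact: (cH t).1.
Qed.

Lemma kernel_op_sum (I : Type) (s : seq I) (F : I -> R -> R -> R[i]) f :
  (forall i t, continuousC (F i t)) -> continuous f ->
  kernel_op (fun t x => \sum_(i <- s) F i t x) f =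
  fun t => \sum_(i <- s) kernel_op (F i) f t.
Proof.
move=> cF cf; apply/funext => t; rewrite /kernel_op -mulr_sumr.
rewrite -int_period_sum.
  congr (_ * _); congr int_period; apply/funext => x.
  by rewrite Re_sum mulr_suml.
by move=> i; apply: continuous_mul => //; exact: (cF i t).1.
Qed.

Lemma kernel_op_linear H : (forall t, continuousC (H t)) ->
  linear_on E (kernel_op H).
Proof.
move=> cH a f g Ef Eg; apply/funext => t.
have [cf cg] := (sine_closure_continuous _ Ef, sine_closure_continuous _ Eg).
rewrite -[RHS]/(a * kernel_op H f t + kernel_op H g t) /kernel_op.
rewrite mulrCA -mulrDr -(int_periodZ a) -?int_periodD.
- congr (_ * _); congr int_period; apply/funext => x.
  by rewrite -[(a *: f + g) x]/(a * f x + g x); ring.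
- apply: continuous_mul; first exact: continuous_const.
  by apply: continuous_mul => //; exact: (cH t).1.
- by apply: continuous_mul => //; exact: (cH t).1.
- by apply: continuous_mul => //; exact: (cH t).1.
Qed.

Lemma kernel_op_le H f (M c : R) t : continuousC (H t) -> continuous f ->
  (forall x, normc (H t x) <= M) -> (forall x, `|f x| <= c) ->
  `|kernel_op H f t| <= M * c.
Proof.
move=> cH cf HM fc; rewrite /kernel_op normrM ger0_norm; last first.
  by rewrite invr_ge0 ltW// twopi_gt0.
rewrite mulrC ler_pdivrMr ?twopi_gt0// mulrC.
apply: int_period_le; first by apply: continuous_mul => //; exact: cH.1.
move=> x; rewrite normrM ler_pM//.
exact: le_trans (Re_le_normc _) (HM x).
Qed.

(** The real part of the exponential is cos (p t) cos (q x) - sin (p t) sin (q x), and its first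
    term integrates to 0 against f. *)
Lemma kernel_op_wave (p q : nat) f : E f ->
  kernel_op (fun t x => expi (- (p%:R * t + q%:R * x))) f =
  fun t => - ((2 * pi)^-1 * int_period (fun x => sin (q%:R * x) * f x))
           * sin (p%:R * t).
Proof.
move=> Ef; apply/funext => t; rewrite /kernel_op.
have cf := sine_closure_continuous _ Ef.
have -> : (fun x => complex.Re (expi (- (p%:R * t + q%:R * x))) * f x) =
    fun x => cos (p%:R * t) * (cos (q%:R * x) * f x) +
      - sin (p%:R * t) * (sin (q%:R * x) * f x).
  by apply/funext => x /=; rewrite cosN cosD; ring.
have c1 : continuous (fun x : R => cos (q%:R * x) * f x).
  by apply: continuous_mul => //; exact: continuous_cosM.
have c2 : continuous (fun x : R => sin (q%:R * x) * f x).
  by apply: continuous_mul => //; exact: continuous_sinM.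
rewrite int_periodD; last 2 first.
- by apply: continuous_mul => //; exact: continuous_const.
- by apply: continuous_mul => //; exact: continuous_const.
by rewrite !int_periodZ// sine_closure_orthogonal//; ring.
Qed.

(* Quantifying over p and q makes this class stable under multiplication by   *)
(* these exponentials, which the induction on geometric sums requires.        *)
Definition sine_kernel H :=
  (forall t, continuousC (H t)) /\
  forall (p q : nat) f, E f ->
    E (kernel_op (fun t x => expi (- (p%:R * t + q%:R * x)) * H t x) f).

Lemma sine_kernel1 : sine_kernel (fun _ _ => 1).
Proof.
split=> [t|p q f Ef]; first exact: continuousC_cst.
under eq_fun do under eq_fun do rewrite mulr1.
rewrite kernel_op_wave//; apply: sine_closureZ; exact: sine_closure_sin.
Qed.

Lemma sine_kernel_wave p q H : sine_kernel H ->
  sine_kernel (fun t x => expi (- (p%:R * t + q%:R * x)) * H t x).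
Proof.
move=> [cH EH]; split=> [t|p' q' f Ef].
  by apply: continuousC_mul => //; exact: continuousC_expi.
have := EH (p' + p)%N (q' + q)%N f Ef.
congr (E (kernel_op _ f)); apply/funext => t; apply/funext => x.
by rewrite mulrA -expiD; congr (expi _ * _); rewrite !natrD; ring.
Qed.

Lemma sine_kernelD H1 H2 : sine_kernel H1 -> sine_kernel H2 ->
  sine_kernel (fun t x => H1 t x + H2 t x).
Proof.
move=> [c1 E1] [c2 E2]; split=> [t|p q f Ef]; first exact: continuousC_add.
have cf := sine_closure_continuous _ Ef.
under eq_fun do under eq_fun do rewrite mulrDr.
rewrite kernel_opD//; first by apply: sine_closureD; [exact: E1|exact: E2].
- by move=> t; apply: continuousC_mul => //; exact: continuousC_expi.
- by move=> t; apply: continuousC_mul => //; exact: continuousC_expi.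
Qed.

Lemma sine_kernelZ (a : R) H : sine_kernel H ->
  sine_kernel (fun t x => a%:C * H t x).
Proof.
move=> [cH EH]; split=> [t|p q f Ef].
  by apply: continuousC_mul => //; exact: continuousC_cst.
under eq_fun do under eq_fun do rewrite mulrCA.
rewrite kernel_opZ; last 2 first.
- by move=> t; apply: continuousC_mul => //; exact: continuousC_expi.
- exact: sine_closure_continuous.
by apply: sine_closureZ; exact: EH.
Qed.

Lemma sine_kernel_sum (I : Type) (s : seq I) (F : I -> R -> R -> R[i]) :
  (forall i, sine_kernel (F i)) ->
  sine_kernel (fun t x => \sum_(i <- s) F i t x).
Proof.
move=> gF; elim: s => [|i s IH].
  have := sine_kernelZ 0 _ sine_kernel1; congr sine_kernel.
  by apply/funext => t; apply/funext => x; rewrite big_nil mul0r.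
have := sine_kernelD _ _ (gF i) IH; congr sine_kernel.
by apply/funext => t; apply/funext => x; rewrite big_cons.
Qed.

Lemma sine_kernel_op H f : sine_kernel H -> E f -> E (kernel_op H f).
Proof.
move=> [_ EH] Ef; have := EH 0%N 0%N _ Ef; congr (E (kernel_op _ f)).
apply/funext => t; apply/funext => x.
by rewrite !mul0r addr0 oppr0 expi0 mul1r.
Qed.

End kernel_op.

(** * The wave sums and the remainder kernel *)

Section resolvent_kernel.
Context {R : realType}.
Variables (m : nat).
Local Notation E := (@sine_closure R).

(** The index i stands for p = i + 1, so that m - i is m + 1 - p. *)
Definition wave_sum (t x : R) : R[i] :=
  \sum_(i < m) expi (- (i.+1%:R * t + (m - i)%:R * x)).

Definition dwave_sum (t x : R) : R[i] :=
  \sum_(i < m) i.+1%:R%:C * expi (- (i.+1%:R * t + (m - i)%:R * x)).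

Lemma continuousC_wave_sum t : continuousC (wave_sum t).
Proof. by apply: continuousC_sum => i; exact: continuousC_expi. Qed.

Lemma continuousC_dwave_sum t : continuousC (dwave_sum t).
Proof.
apply: continuousC_sum => i; apply: continuousC_mul.
  exact: continuousC_cst.
exact: continuousC_expi.
Qed.

Lemma normc_wave_sum t x : normc (wave_sum t x) <= m%:R.
Proof.
apply: le_trans (normc_sum _ _ _) _.
under eq_bigr do rewrite normc_expi.
by rewrite sumr_const card_ord.
Qed.

Lemma normc_dwave_sum t x : normc (dwave_sum t x) <= m%:R * m%:R.
Proof.
apply: le_trans (normc_sum _ _ _) _.
under eq_bigr do rewrite normcM normc_expi mulr1 normc_real ger0_norm ?ler0n//.
apply: (@le_trans _ _ (\sum_(i < m) (m%:R : R))).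
  by apply: ler_sum => i _; rewrite ler_nat.
by rewrite sumr_const card_ord mulr_natl.
Qed.

Variables (delta : R).
Hypothesis deltam : `|delta| * m%:R <= 2^-1.

Lemma normc_delta_wave_sum t x : normc (delta%:C * wave_sum t x) <= 2^-1.
Proof.
rewrite normcM normc_real; apply: le_trans deltam.
by rewrite ler_wpM2l// normc_wave_sum.
Qed.

Lemma normc_one_sub_ge t x : 2^-1 <= normc (1 - delta%:C * wave_sum t x).
Proof.
have := le_normcD (1 - delta%:C * wave_sum t x) (delta%:C * wave_sum t x).
rewrite subrK normc1 => /le_trans h.
have := h _ (lerD (lexx _) (normc_delta_wave_sum t x)).
set y := normc _; lra.
Qed.

Lemma one_sub_neq0 t x : 1 - delta%:C * wave_sum t x != 0.
Proof.
apply/eqP => h; have := normc_one_sub_ge t x; rewrite h normc0.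
by rewrite leNgt invr_gt0 ltr0n.
Qed.

Definition remainder_kernel (t x : R) : R[i] :=
  dwave_sum t x * wave_sum t x * (1 - delta%:C * wave_sum t x)^-1.

Lemma continuousC_remainder_kernel t : continuousC (remainder_kernel t).
Proof.
apply: continuousC_mul; first apply: continuousC_mul.
- exact: continuousC_dwave_sum.
- exact: continuousC_wave_sum.
- apply: continuousC_inv; last by move=> x; exact: one_sub_neq0.
  have -> : (fun x => 1 - delta%:C * wave_sum t x) =
      fun x => 1 + (- delta)%:C * wave_sum t x.
    by apply/funext => x; rewrite rmorphN mulNr.
  apply: continuousC_add; first exact: continuousC_cst.
  apply: continuousC_mul; first exact: continuousC_cst.
  exact: continuousC_wave_sum.
Qed.

Lemma normc_inv_one_sub t x : normc (1 - delta%:C * wave_sum t x)^-1 <= 2.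
Proof.
rewrite normcV -[leRHS]invrK lef_pV2 ?normc_one_sub_ge//.
- by rewrite posrE; apply: lt_le_trans (normc_one_sub_ge t x); rewrite invr_gt0.
- by rewrite posrE invr_gt0.
Qed.

Lemma normc_remainder_kernel t x :
  normc (remainder_kernel t x) <= m%:R * m%:R * m%:R * 2.
Proof.
rewrite !normcM; apply: ler_pM; rewrite ?mulr_ge0 ?normc_ge0//; last first.
  exact: normc_inv_one_sub.
by apply: ler_pM; rewrite ?normc_ge0 ?normc_wave_sum ?normc_dwave_sum.
Qed.

(** Horner form of the sum of (delta S)^k over k < n, with S the wave sum. *)
Fixpoint geometric_kernel (n : nat) (t x : R) : R[i] :=
  if n is n'.+1 then 1 + delta%:C * (wave_sum t x * geometric_kernel n' t x)
  else 0.

Lemma sine_kernel_geometric n : sine_kernel (geometric_kernel n).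
Proof.
elim: n => [|n IH] /=.
  have := sine_kernelZ 0 _ (@sine_kernel1 R); congr sine_kernel.
  by apply/funext => t; apply/funext => x; rewrite mul0r.
apply: sine_kernelD; first exact: sine_kernel1.
apply: sine_kernelZ.
have := sine_kernel_sum _ (index_enum 'I_m) _
  (fun i : 'I_m => sine_kernel_wave i.+1 (m - i)%N _ IH).
by congr sine_kernel; apply/funext => t; apply/funext => x; rewrite mulr_suml.
Qed.

Lemma geometric_kernelE n t x :
  (1 - delta%:C * wave_sum t x)^-1 - geometric_kernel n t x =
  (delta%:C * wave_sum t x) ^+ n * (1 - delta%:C * wave_sum t x)^-1.
Proof.
elim: n => [|n IH] /=; first by rewrite subr0 expr0 mul1r.
rewrite exprS -mulrA -IH; have := one_sub_neq0 t x.
by move=> h; field.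
Qed.

(** Replacing 1 / (1 - delta S) by a partial sum of its geometric series gives a combination of
    exponentials, which preserves E. As |delta S| <= 1/2, the error is O(2^-N) uniformly in t, and E
    is closed under uniform limits. *)
Lemma sine_closure_remainder f : E f -> E (kernel_op remainder_kernel f).
Proof.
move=> Ef.
have cf := sine_closure_continuous _ Ef.
have [c0 Hc0] := sine_closure_bounded f Ef.
pose c := c0 + 1.
have c_gt0 : 0 < c by rewrite ltr_wpDl// (le_trans (normr_ge0 _) (Hc0 0)).
have Hc x : `|f x| <= c by apply: le_trans (Hc0 x) _; rewrite lerDl.
apply: sine_closure_uniformly_closed => e e0.
pose K : R := m%:R * m%:R * m%:R * 2.
have K0 : 0 <= K by rewrite /K !mulr_ge0.
have pow0 : (fun n => (K * c) * 2^-1 ^+ n : R) @ \oo --> (0 : R).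
  have := @cvg_geometric R (K * c) (2^-1).
  by apply; rewrite ger0_norm ?invr_ge0// invf_lt1// ltr1n.
have /cvgrPdist_le /(_ e e0) [N _ /(_ N (leqnn N)) HN] := pow0.
pose HNk t x := dwave_sum t x * (wave_sum t x * geometric_kernel N t x).
have sk : sine_kernel HNk.
  have h1 := sine_kernel_sum _ (index_enum 'I_m) _
    (fun i : 'I_m => sine_kernel_wave i.+1 (m - i)%N _ (sine_kernel_geometric N)).
  have := sine_kernel_sum _ (index_enum 'I_m) _
    (fun i : 'I_m => sine_kernelZ i.+1%:R _
      (sine_kernel_wave i.+1 (m - i)%N _ h1)).
  congr sine_kernel; apply/funext => t; apply/funext => x.
  rewrite /HNk mulr_suml; apply: eq_bigr => i _.
  by rewrite mulrA mulr_suml.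
exists (kernel_op HNk f); first exact: sine_kernel_op.
move=> t.
pose D t x := remainder_kernel t x + (-1)%:C * HNk t x.
have cD s : continuousC (D s).
  apply: continuousC_add; first exact: continuousC_remainder_kernel.
  by apply: continuousC_mul; [exact: continuousC_cst|exact: sk.1].
have -> : kernel_op remainder_kernel f t - kernel_op HNk f t = kernel_op D f t.
  rewrite /D kernel_opD// ?kernel_opZ ?mulN1r//;
    [exact: sk.1|exact: continuousC_remainder_kernel|].
  by move=> s; apply: continuousC_mul; [exact: continuousC_cst|exact: sk.1].
have DE x : D t x = remainder_kernel t x * (delta%:C * wave_sum t x) ^+ N.
  rewrite /D /HNk rmorphN1 mulN1r mulrA -mulrBr.
  by rewrite geometric_kernelE mulrCA mulrC.
apply: le_trans (kernel_op_le D f (K * 2^-1 ^+ N) c t (cD t) cf _ Hc) _.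
  move=> x; rewrite DE normcM normcX; apply: ler_pM; rewrite ?normc_ge0//.
  - by rewrite exprn_ge0// normc_ge0.
  - exact: normc_remainder_kernel.
  - by rewrite lerXn2r// ?nnegrE ?normc_ge0 ?invr_ge0// normc_delta_wave_sum.
rewrite mulrAC; move: HN; rewrite /= sub0r normrN; exact/le_trans/ler_norm.
Qed.

End resolvent_kernel.

(** * The reduced resolvent of the leading operator *)

Lemma scale_reg {R : realType} (a x : R) : a *: (x : R^o) = a * x.
Proof. by []. Qed.

Section reduced_resolvent.
Context {R : realType} {T : Type} {m : nat}.
Variables (E : set (T -> R)) (s : 'I_m -> T -> R).
Variables (alpha : 'I_m -> (T -> R) -> R) (w : 'I_m -> R).
Variables (A : (T -> R) -> T -> R) (nu : R).
Hypotheses (linE : combination_closed E) (E0 : E 0) (Es : forall i, E (s i)).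
Hypothesis linA : linear_on E A.
Hypothesis lin_alpha : forall i, linear_on E (alpha i : _ -> R^o).
Hypothesis alpha_s : forall i k, alpha i (s k) = (i == k)%:R.
Hypothesis AE : forall f, E f ->
  A f = \sum_p alpha p f *: (w (rev_ord p) *: s (rev_ord p)).
Hypothesis nu0 : nu != 0.

Local Notation d p := (w p * w (rev_ord p)).

(* With d p the eigenvalue of A ^ 2 on s p, inverts A - nu on its generalized *)
(* eigenspaces: by (A + nu) / (d p - nu ^ 2) if d p != nu ^ 2, and by         *)
(* -1 / (2 nu) on the remaining eigenspace of -nu. Where A vanishes this is   *)
(* -1 / nu, the other terms being corrections of finite rank.                 *)
Definition resolvent_vector (p : 'I_m) : T -> R :=
  if d p == nu ^+ 2 then (2 * nu)^-1 *: s p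
  else (d p - nu ^+ 2)^-1 *: (w (rev_ord p) *: s (rev_ord p) + nu *: s p)
       + nu^-1 *: s p.

Definition reduced_resolvent (f : T -> R) : T -> R :=
  - nu^-1 *: f + \sum_p alpha p f *: resolvent_vector p.

Let EZ := combination_closedZ E linE E0.
Let ED := combination_closedD E linE.

Let AD := linear_onD E _ _ linA.
Let AZ := linear_onZ E E0 _ _ linA.
Let Asum := linear_on_sum E linE E0 _ _ linA.

Lemma resolvent_vector_closed p : E (resolvent_vector p).
Proof.
rewrite /resolvent_vector; case: ifP => _; first exact: EZ.
by apply: ED; [apply: EZ; apply: ED; exact: EZ|exact: EZ].
Qed.

Lemma reduced_resolvent_closed f : E f -> E (reduced_resolvent f).
Proof.
move=> Ef; apply: ED; first exact: EZ.
apply: (combination_closed_sum E linE E0) => p; apply: EZ.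
exact: resolvent_vector_closed.
Qed.

Lemma reduced_resolvent_linear : linear_on E reduced_resolvent.
Proof.
move=> a f g Ef Eg; rewrite /reduced_resolvent.
rewrite [X in _ = X + _]scalerDr scaler_sumr addrACA -big_split /=; congr (_ + _).
  by rewrite scalerDr !scalerA mulrC.
by apply: eq_bigr => p _; rewrite lin_alpha// scale_reg scalerDl scalerA.
Qed.

Lemma A_s p : A (s p) = w (rev_ord p) *: s (rev_ord p).
Proof.
rewrite AE// (bigD1 p)//= alpha_s eqxx scale1r big1 ?addr0// => i ip.
by rewrite alpha_s (negbTE ip) scale0r.
Qed.

Lemma A_alpha f : E f -> A f = \sum_p alpha p f *: A (s p).
Proof. by move=> Ef; rewrite AE//; apply: eq_bigr => p _; rewrite A_s. Qed.

Lemma alpha_A i f : E f -> alpha i (A f) = w i * alpha (rev_ord i) f.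
Proof.
move=> Ef; rewrite AE// (linear_on_sum E linE E0 _ _ (lin_alpha i))//; last first.
  by move=> p; do 2 apply: EZ.
rewrite (bigD1 (rev_ord i))//= big1 => [|p pi].
  rewrite !(linear_onZ E E0 _ _ (lin_alpha i))//; [|exact: EZ].
  by rewrite rev_ordK alpha_s eqxx addr0 !scale_reg mulr1 mulrC.
rewrite !(linear_onZ E E0 _ _ (lin_alpha i))//; [|exact: EZ].
rewrite alpha_s (_ : (i == rev_ord p) = false) ?scaler0//.
by apply/negbTE; apply: contra pi => /eqP ->; rewrite rev_ordK.
Qed.

(** Since (A - nu) (- nu^-1 f) = f - nu^-1 A f, an exact right inverse requires A - nu to send the
    resolvent vector of p to nu^-1 A (s p). This holds when d p differs from nu^2; otherwise the
    defect is a multiple of (A + nu) (s p), which lies in the kernel of A - nu. *)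
Lemma A_resolvent_vector p :
  A (resolvent_vector p) - nu *: resolvent_vector p - nu^-1 *: A (s p) =
  if d p == nu ^+ 2
  then - (2 * nu)^-1 *: (w (rev_ord p) *: s (rev_ord p) + nu *: s p) else 0.
Proof.
have EA k : E (w k *: s k) by exact: EZ.
rewrite /resolvent_vector; case: ifPn => [_|dn].
  rewrite AZ// A_s; apply/funext => t.
  rewrite -[LHS]/((2 * nu)^-1 * (w (rev_ord p) * s (rev_ord p) t) -
     nu * ((2 * nu)^-1 * s p t) - nu^-1 * (w (rev_ord p) * s (rev_ord p) t)).
  rewrite -[RHS]/(- (2 * nu)^-1 * (w (rev_ord p) * s (rev_ord p) t + nu * s p t)).
  by field.
rewrite AD//; [|by apply: EZ; apply: ED; exact: EZ|exact: EZ].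
rewrite !AZ//; last by apply: ED; exact: EZ.
rewrite AD//; last exact: EZ.
rewrite !AZ// !A_s rev_ordK; apply/funext => t.
rewrite -[LHS]/((d p - nu ^+ 2)^-1 * (w (rev_ord p) * (w p * s p t)
    + nu * (w (rev_ord p) * s (rev_ord p) t))
  + nu^-1 * (w (rev_ord p) * s (rev_ord p) t)
  - nu * ((d p - nu ^+ 2)^-1 * (w (rev_ord p) * s (rev_ord p) t + nu * s p t)
       + nu^-1 * s p t)
  - nu^-1 * (w (rev_ord p) * s (rev_ord p) t)).
rewrite -[RHS]/(0 : R) -subr_eq0 in dn *.
rewrite (_ : w (rev_ord p) * (w p * s p t) = (d p - nu ^+ 2) * s p t + nu ^+ 2 * s p t).
  by field; rewrite nu0.
by ring.
Qed.

(** On the span of the s p with d p = nu^2 one has A^2 = nu^2, so (A + nu) / (2 nu) projects onto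
    the eigenspace of nu. The hypothesis says that f has no component there, and then the defects of
    [A_resolvent_vector] add up to 0. *)
Lemma reduced_resolventP f : E f ->
  \sum_(p | d p == nu ^+ 2)
     alpha p f *: (w (rev_ord p) *: s (rev_ord p) + nu *: s p) = 0 ->
  A (reduced_resolvent f) = nu *: reduced_resolvent f + f.
Proof.
move=> Ef Hf.
have EV p : E (alpha p f *: resolvent_vector p).
  by apply: EZ; exact: resolvent_vector_closed.
rewrite /reduced_resolvent AD//; last 2 first.
- exact: EZ.
- exact: (combination_closed_sum E linE E0).
rewrite AZ// Asum//.
under eq_bigr do rewrite (AZ _ _ (resolvent_vector_closed _)).
apply/eqP; rewrite -subr_eq0; apply/eqP.
rewrite {1}(A_alpha _ Ef) scalerDr scalerA mulrN mulfV// scaleN1r.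
transitivity (\sum_p alpha p f *:
  (A (resolvent_vector p) - nu *: resolvent_vector p - nu^-1 *: A (s p))).
  under [RHS]eq_bigr do rewrite scalerBr scalerBr.
  rewrite !sumrB; set X := \sum_p _ *: A (resolvent_vector p).
  rewrite scaler_sumr scaleNr scaler_sumr.
  rewrite [X in _ = _ - X - _](eq_bigr (fun p =>
    nu *: (alpha p f *: resolvent_vector p))); last first.
    by move=> p _; rewrite !scalerA mulrC.
  rewrite [X in _ = _ - X](eq_bigr (fun p => nu^-1 *: (alpha p f *: A (s p)))); last first.
    by move=> p _; rewrite !scalerA mulrC.
  set Y := \sum_p _; set Z := \sum_p _.
  apply/funext => t; rewrite -[LHS]/(- Y t + X t - (- f t + Z t + f t)).
  by rewrite -[RHS]/(X t - Z t - Y t); ring.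
under eq_bigr do rewrite A_resolvent_vector.
transitivity (- (2 * nu)^-1 *: \sum_(p | d p == nu ^+ 2)
     alpha p f *: (w (rev_ord p) *: s (rev_ord p) + nu *: s p)).
  rewrite scaler_sumr [RHS]big_mkcond; apply: eq_bigr => p _.
  by case: ifP => _; rewrite ?scaler0// !scalerA mulrC.
by rewrite Hf scaler0.
Qed.

(** Applying b to A (A (s p)) shows that b vanishes on every s p with d p != nu^2. Hence b of the
    reduced resolvent of f is (2 nu)^-1 times the sum of the alpha p f b (s p), while nu times this
    sum is b (A f) = nu b f = 0. *)
Lemma reduced_resolvent_ker (b : (T -> R) -> R) f :
  linear_on E (b : _ -> R^o) -> (forall f, E f -> b (A f) = nu * b f) ->
  E f -> b f = 0 -> b (reduced_resolvent f) = 0.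
Proof.
move=> linb bA Ef bf.
have bD := linear_onD E _ _ linb; have bZ := linear_onZ E E0 _ _ linb.
have bsum := linear_on_sum E linE E0 _ _ linb.
have EV p : E (alpha p f *: resolvent_vector p).
  by apply: EZ; exact: resolvent_vector_closed.
have bs p : d p != nu ^+ 2 -> b (s p) = 0.
  move=> dp.
  have h : nu ^+ 2 * b (s p) = d p * b (s p).
    rewrite expr2 -mulrA -bA// A_s bZ//.
    rewrite scale_reg mulrCA -bA// A_s rev_ordK bZ//.
    by rewrite scale_reg; ring.
  apply/eqP; move/eqP: h; rewrite -subr_eq0 -mulrBl mulf_eq0 subr_eq0 eq_sym.
  by rewrite (negbTE dp).
have bV p : b (resolvent_vector p) = (2 * nu)^-1 * b (s p).
  rewrite /resolvent_vector; case: ifPn => [_|dn].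
    by rewrite bZ.
  (* Reversal only exchanges the factors of d, so b also vanishes on [s (rev_ord p)] and both sides
     are 0. *)
  have dn' : d (rev_ord p) != nu ^+ 2 by rewrite rev_ordK mulrC.
  rewrite bD//; [|by apply: EZ; apply: ED; exact: EZ|exact: EZ].
  rewrite !bZ//; last by apply: ED; exact: EZ.
  rewrite bD//; [|exact: EZ|exact: EZ].
  by rewrite !bZ// !bs// !scale_reg !(mulr0, addr0).
rewrite /reduced_resolvent bD//; last 2 first.
- exact: EZ.
- exact: (combination_closed_sum E linE E0).
rewrite bZ// bf scale_reg mulr0 add0r.
rewrite bsum//.
under eq_bigr do rewrite (bZ _ _ (resolvent_vector_closed _)) bV scale_reg.
have : b (A f) = 0 by rewrite bA// bf mulr0.
rewrite (A_alpha _ Ef) bsum//; last first.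
  by move=> p; apply: EZ; rewrite A_s; exact: EZ.
have bAs p : b (alpha p f *: A (s p)) = nu * (alpha p f * b (s p)).
  by rewrite bZ// ?bA// ?scale_reg ?A_s; [ring|exact: EZ].
rewrite (eq_bigr _ (fun p _ => bAs p)).
rewrite -mulr_sumr => /eqP; rewrite mulf_eq0 (negbTE nu0)/= => /eqP h.
under eq_bigr do rewrite mulrCA.
by rewrite -mulr_sumr h mulr0.
Qed.

Lemma reduced_resolvent_bounded (a : R) :
  (forall p t, `|s p t| <= 1) ->
  (forall p f (c : R), E f -> (forall t, `|f t| <= c) -> `|alpha p f| <= a * c) ->
  exists2 K : R, 0 <= K & forall f (c : R), E f -> (forall t, `|f t| <= c) ->
    forall t, `|reduced_resolvent f t| <= K * c.
Proof.
move=> s1 ba.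
pose gam p := `|(2 * nu)^-1| +
  (`|(d p - nu ^+ 2)^-1| * (`|w (rev_ord p)| + `|nu|) + `|nu^-1|).
have gam0 p : 0 <= gam p.
  by rewrite /gam !addr_ge0// mulr_ge0// addr_ge0.
have bs (z : R) p t : `|z * s p t| <= `|z|.
  by rewrite normrM -[leRHS]mulr1 ler_wpM2l.
have gb p t : `|resolvent_vector p t| <= gam p.
  rewrite /resolvent_vector /gam; case: ifPn => _.
    by apply: le_trans (bs _ _ _) _; rewrite lerDl addr_ge0// mulr_ge0// addr_ge0.
  apply: (@le_trans _ _ (`|(d p - nu ^+ 2)^-1| * (`|w (rev_ord p)| + `|nu|) + `|nu^-1|)).
    rewrite -[X in `|X|]/((d p - nu ^+ 2)^-1 * (w (rev_ord p) * s (rev_ord p) t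
      + nu * s p t) + nu^-1 * s p t).
    apply: le_trans (ler_normD _ _) _; apply: lerD => //.
    rewrite normrM ler_wpM2l//.
    by apply: le_trans (ler_normD _ _) _; apply: lerD.
  by rewrite lerDr.
exists (`|nu^-1| + `|a| * \sum_p gam p).
  by rewrite addr_ge0// mulr_ge0// sumr_ge0.
move=> f c Ef fc t.
have c0 : 0 <= c by apply: le_trans (fc t).
have -> : reduced_resolvent f t =
    - nu^-1 * f t + \sum_p alpha p f * resolvent_vector p t.
  rewrite /reduced_resolvent -[LHS]/(- nu^-1 * f t + (\sum_p _) t); congr (_ + _).
  by rewrite fct_sumE.
apply: le_trans (ler_normD _ _) _; rewrite mulrDl; apply: lerD.
  by rewrite normrM normrN ler_wpM2l.
rewrite mulr_sumr mulr_suml; apply: le_trans (ler_norm_sum _ _ _) _.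
apply: ler_sum => p _; rewrite normrM mulrAC ler_pM//.
apply: le_trans (ba _ _ _ Ef fc) _.
by rewrite ler_wpM2r// ler_norm.
Qed.

End reduced_resolvent.

(** * The Neumann-Poincare kernel *)

Section boundary_kernel.
Context {R : realType}.

Lemma dotC_ge0 (z : R[i]) : 0 <= dotC z z.
Proof. by rewrite /dotC -!expr2 addr_ge0// sqr_ge0. Qed.

Lemma dotC_eq0 (z : R[i]) : (dotC z z == 0) = (z == 0).
Proof.
rewrite /dotC eq_complex -!expr2 paddr_eq0 ?sqr_ge0// !expf_eq0/=.
by case: z.
Qed.

Lemma absC_sqr (z : R[i]) : absC z ^+ 2 = dotC z z.
Proof. by rewrite /absC sqr_sqrtr// dotC_ge0. Qed.

Lemma absCE (z : R[i]) : absC z = normc z.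
Proof. by case: z => a b; rewrite /absC /dotC /= -!expr2. Qed.

(** Turns the Neumann-Poincare kernel into the real part of a complex quotient, to be computed by
    algebra in zeta and w. *)
Lemma dotC_div (z w : R[i]) : dotC z w / absC z ^+ 2 = complex.Re (w / z).
Proof.
rewrite absC_sqr /dotC; case: z => a b; case: w => c d /=; rewrite -!expr2.
by ring.
Qed.

Lemma dotC_scale (z w : R[i]) (a : R) : dotC z (a%:C * w) = a * dotC z w.
Proof. by rewrite /dotC; case: z => x y; case: w => c d /=; ring. Qed.

(** For zeta and w on the unit circle, |zeta - w|^2 = 2 <zeta - w, zeta>. This constant is all that
    remains of the kernel for a disk. *)
Lemma Re_unit_div (t x : R) : expi t != expi x ->
  complex.Re (expi t / (expi t - expi x)) = 2^-1.
Proof.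
move=> tx; rewrite -dotC_div absC_sqr.
have n0 : dotC (expi t - expi x) (expi t - expi x) != 0.
  by rewrite dotC_eq0 subr_eq0.
have e : dotC (expi t - expi x) (expi t - expi x) =
    2 * dotC (expi t - expi x) (expi t).
  rewrite /dotC /=; have := cos2Dsin2 t; have := cos2Dsin2 x.
  move: (cos t) (sin t) (cos x) (sin x) => a b c d h1 h2.
  transitivity ((c ^+ 2 + d ^+ 2) - (a ^+ 2 + b ^+ 2)
    + 2 * ((a - c) * a + (b - d) * b)); first by ring.
  by rewrite h1 h2 subrr add0r.
rewrite e in n0 *; rewrite invfM mulrCA mulfV ?mulr1//.
by move: n0; rewrite mulf_eq0 negb_or => /andP[].
Qed.

Variables (m : nat) (rho0 delta : R).
Local Notation W := (wave_sum m).
Local Notation P := (dwave_sum m).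

Let B (t x : R) (i : nat) := expi (- (i%:R * t + (m - i)%:R * x)).

Let mul_waveL (t x : R) (i : 'I_m) :
  expi t * expi (- (i.+1%:R * t + (m - i)%:R * x)) = B t x i.
Proof. by rewrite /B -expiD -natr1; congr expi; ring. Qed.

Let mul_waveR (t x : R) (i : 'I_m) :
  expi x * expi (- (i.+1%:R * t + (m - i)%:R * x)) = B t x i.+1.
Proof.
rewrite /B -expiD; congr expi.
have -> : (m - i)%:R = (m - i.+1)%:R + 1 :> R by rewrite natr1 subnSK.
by rewrite -[i.+1%:R]natr1; ring.
Qed.

Lemma sub_mul_wave_sum (t x : R) :
  (expi t - expi x) * W t x = expi (- (m%:R * x)) - expi (- (m%:R * t)).
Proof.
rewrite /wave_sum mulr_sumr.
under eq_bigr do rewrite mulrBl mul_waveL mul_waveR -opprB.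
rewrite sumrN -(big_mkord xpredT (fun i => B t x i.+1 - B t x i)).
rewrite telescope_sumr// opprB /B subn0 subnn !mul0r addr0 add0r.
by [].
Qed.

(** Summation by parts. With B_i = zeta^-i w^-(m-i), each term p (B_(p-1) - B_p) is B_(p-1) minus
    the increment of p B_p; the first parts sum to zeta S and the increments to m zeta^-m. *)
Lemma sub_mul_dwave_sum (t x : R) :
  (expi t - expi x) * P t x = expi t * W t x - m%:R%:C * expi (- (m%:R * t)).
Proof.
rewrite /wave_sum /dwave_sum !mulr_sumr.
apply/eqP; rewrite -subr_eq0 opprB addrCA -sumrB.
under eq_bigr => i _.
  rewrite mulrCA mulrBl mul_waveL mul_waveR.
  rewrite (_ : _ - _ = - (i.+1%:R%:C * B t x i.+1 - i%:R%:C * B t x i)); last first.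
    by rewrite -[i.+1%:R]natr1 rmorphD rmorph1; ring.
  over.
rewrite sumrN -(big_mkord xpredT (fun i => i.+1%:R%:C * B t x i.+1 - i%:R%:C * B t x i)).
rewrite (telescope_sumr (fun i => i%:R%:C * B t x i))//.
by rewrite /B subnn !mul0r addr0 subr0 subrr.
Qed.

Lemma bdry_sub t x : bdry m rho0 delta t - bdry m rho0 delta x =
  (expR rho0)%:C * ((expi t - expi x) * (1 - delta%:C * W t x)).
Proof.
rewrite /bdry mulrBr mulr1 mulrCA sub_mul_wave_sum; ring.
Qed.

Lemma dPhiE t x : dPhi m rho0 delta t = (expR rho0)%:C *
  (expi t * (1 - delta%:C * W t x) + delta%:C * ((expi t - expi x) * P t x)).
Proof. by rewrite /dPhi sub_mul_dwave_sum rmorphM; ring. Qed.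

Hypothesis deltam : `|delta| * m%:R <= 2^-1.

(** Dividing [dPhiE] by [bdry_sub] gives zeta / (zeta - w) + delta P / (1 - delta S), whose second
    term is delta P + delta^2 P S / (1 - delta S). *)
Lemma boundary_kernelE t x :
  dotC (bdry m rho0 delta t - bdry m rho0 delta x) (normal m rho0 delta t)
    / absC (bdry m rho0 delta t - bdry m rho0 delta x) ^+ 2 =
  if expi t == expi x then 0 else (J m rho0 delta t)^-1 *
    (2^-1 + complex.Re (delta%:C * P t x +
               (delta ^+ 2)%:C * remainder_kernel m delta t x)).
Proof.
have s0 := one_sub_neq0 m delta deltam t x.
rewrite /normal dotC_scale -mulrA dotC_div bdry_sub (dPhiE t x).
case: ifPn => [/eqP ->|tx].
  by rewrite subrr !mul0r !mulr0 invr0 !mulr0.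
congr (_ * _); rewrite -(Re_unit_div t x tx) -Re_add; congr (complex.Re _).
have e0 : (expR rho0)%:C != 0.
  by rewrite eq_complex /= eqxx andbT gt_eqF// expR_gt0.
have tx0 : expi t - expi x != 0 by rewrite subr_eq0.
rewrite /remainder_kernel rmorphXn /=.
move: s0 e0 tx0; set s := W t x; set e := (expR rho0)%:C; set d := delta%:C.
set p := P t x; set z := expi t; set w := expi x => s0 e0 tx0.
by field; rewrite s0 e0 tx0.
Qed.

Lemma J_bounds t : expR rho0 / 2 <= J m rho0 delta t <= expR rho0 * 2.
Proof.
rewrite /J absCE /dPhi normcM normc_real ger0_norm ?expR_ge0//.
rewrite !ler_wpM2l ?expR_ge0//.
  apply: le_trans (le_normcD _ _) _; rewrite normcN normcM !normc_expi normc_real.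
  by rewrite mulr1 normrM normr_nat mulrC; move: deltam; lra.
have := le_normcD (expi t - (m%:R * delta)%:C * expi (- (m%:R * t)))
  ((m%:R * delta)%:C * expi (- (m%:R * t))).
rewrite subrK normcM !normc_expi normc_real mulr1 normrM normr_nat mulrC.
by move: deltam; set y := normc _; lra.
Qed.

Lemma J_gt0 t : 0 < J m rho0 delta t.
Proof.
have /andP[h _] := J_bounds t.
by apply: lt_le_trans h; rewrite divr_gt0// expR_gt0.
Qed.

End boundary_kernel.

Section circle_injective.
Context {R : realType}.

(** Reduces the diagonal of the kernel to at most one parameter of the period, hence to a null set.
    If t < x, then cos (x - t) = 1 gives sin ((x - t) / 2) = 0 at a half-angle strictly between 0
    and pi. *)
Lemma expi_inj (t x : R) : 0 <= t < 2 * pi -> 0 <= x < 2 * pi ->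
  expi t = expi x -> t = x.
Proof.
wlog tx : t x / t <= x.
  by move=> H ht hx e; case: (leP t x) => [|/ltW] h; [exact: H|exact/esym/H].
move=> /andP[t0 t1] /andP[x0 x1] [ec es].
apply/eqP; rewrite eq_le tx leNgt/=; apply/negP => tx'.
have : 0 < sin ((x - t) / 2).
  by apply: sin_gt0_pi; apply/andP; split; lra.
have e : x - t = ((x - t) / 2) *+ 2 by rewrite mulr2n; field.
have : sin ((x - t) / 2) ^+ 2 = 0.
  have : cos (x - t) = 1 by rewrite cosB ec es -!expr2 cos2Dsin2.
  rewrite [in cos (x - t)]e cos_mulr2n; have := cos2Dsin2 ((x - t) / 2).
  move: (cos _) (sin _) => c s; rewrite -[c ^+ 2 *+ 2]mulr_natl => h1 h2; lra.
by move=> /eqP; rewrite expf_eq0/= => /eqP ->; rewrite ltxx.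
Qed.

End circle_injective.

(** * The arc-length measure *)

Section arclength.
Context {R : realType}.
Variables (m : nat) (rho0 delta : R).
Local Notation sigma := (arclength m rho0 delta).
Local Notation mu := (@lebesgue_measure R).
Local Notation D := (`[0%R, (2 * pi)%R[%classic : set R).

Lemma J_le t : J m rho0 delta t <= expR rho0 * (1 + m%:R * `|delta|).
Proof.
rewrite /J absCE /dPhi normcM normc_real ger0_norm ?expR_ge0// ler_wpM2l ?expR_ge0//.
apply: le_trans (le_normcD _ _) _; rewrite normcN normcM !normc_expi normc_real.
by rewrite mulr1 normrM normr_nat.
Qed.

Lemma arclength_le (A : set R) (c : R) : measurable A ->
  (forall t, J m rho0 delta t <= c) -> (sigma A <= (c * (2 * pi))%:E)%E.
Proof.
move=> mA Jc.
have mD : measurable D by exact: measurable_itv.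
apply: (@le_trans _ _ (\int[mu]_(t in D) (J m rho0 delta t)%:E)%E).
  apply: ge0_subset_integral => //; first exact: measurableI.
  - apply: measurable_funTS; apply/measurable_EFinP; exact: measurable_J.
  - by move=> t _; rewrite lee_fin J_ge0.
apply: (@le_trans _ _ (\int[mu]_(t in D) (cst c%:E) t)%E).
  apply: ge0_le_integral => //.
  - by move=> t _; rewrite lee_fin J_ge0.
  - apply: measurable_funTS; apply/measurable_EFinP; exact: measurable_J.
  - by move=> t _; rewrite lee_fin.
rewrite integral_cst//= [X in (_ * X)%E](_ : _ = (2 * pi)%:E)//.
apply: etrans (lebesgue_measure_itv `[0, 2 * pi[) _.
by rewrite /= lte_fin twopi_gt0 sube0.
Qed.

Lemma arclength_fin : fin_num_fun (sigma : set R -> \bar R).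
Proof.
move=> A mA; rewrite ge0_fin_numE//.
by apply: le_lt_trans (arclength_le A _ mA J_le) _; rewrite ltry.
Qed.

(* lebesgue_measure lives on a copy of R with another display, hence the      *)
(* transport of arclength along the identity.                                 *)
Let idR : R -> measurableTypeR R := idfun.

Let midR : measurable_fun setT idR.
Proof. exact: (@measurable_id _ R setT). Qed.

Let sigmaL : set (measurableTypeR R) -> \bar R := pushforward sigma idR.

#[local] HB.instance Definition _ := isMeasure.Build _ _ _ sigmaL
  (measure0 sigma) (measure_ge0 sigma) (@measure_semi_sigma_additive _ _ _ sigma).

#[local] HB.instance Definition _ := Measure_isFinite.Build _ _ _
  sigmaL arclength_fin.

Lemma arclength_dominated : sigmaL `<< mu.
Proof.
apply/null_content_dominatesP => A mA A0.
apply: null_set_integral.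
- by apply: measurableI => //; exact: measurable_itv.
- apply: measurable_funTS; apply/measurable_EFinP; exact: measurable_J.
- by apply: (subset_measure0 _ _ _ A0) => //; apply: measurableI => //; exact: measurable_itv.
Qed.

(** J times the indicator of a period is the Radon-Nikodym density of arc length; f is integrable
    because it is bounded and the total length is finite. *)
Lemma integral_arclength (f : R -> R) (M : R) : measurable_fun setT f ->
  (forall t, `|f t| <= M) ->
  (\int[sigma]_t (f t)%:E = \int[mu]_(t in D) (f t * J m rho0 delta t)%:E)%E.
Proof.
move=> mf fM.
have mD : measurable D by exact: measurable_itv.
have mJ : measurable_fun setT (J m rho0 delta) by exact: measurable_J.
have fin : (sigma setT < +oo)%E.
  by have := arclength_le setT _ measurableT J_le => /le_lt_trans; apply; rewrite ltry.
have bf : [bounded f x | x in setT].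
  by exists M; split; [exact: num_real|] => x Mx t _ /=; apply: le_trans (fM t) (ltW Mx).
have fint : sigmaL.-integrable setT (EFin \o f).
  exact: measurable_bounded_integrable.
transitivity (\int[sigmaL]_t (f t)%:E)%E.
  apply/esym; apply: etrans (@integral_pushforward _ _ R (measurableTypeR R) R
    idR midR sigma setT (EFin \o f) _ _ measurableT) _ => //.
  - exact/measurable_EFinP.
  - by rewrite preimage_setT; exact: measurable_bounded_integrable.
rewrite -(Radon_Nikodym_change_of_variables arclength_dominated)//.
rewrite [RHS]integral_mkcond.
have mJD : measurable_fun setT (((fun t => (J m rho0 delta t)%:E) \_ D) : R -> \bar R).
  by apply/(measurable_restrictT _ mD)/measurable_funTS/measurable_EFinP.
transitivity (\int[mu]_t ((f t)%:E * ((fun t => (J m rho0 delta t)%:E) \_ D) t))%E.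
  apply: ae_eq_integral => //.
  - apply: emeasurable_funM; first exact/measurable_EFinP.
    apply: (measurable_int mu).
    by apply: Radon_Nikodym_integrable; exact: arclength_dominated.
  - by apply: emeasurable_funM => //; exact/measurable_EFinP.
  apply: ae_eqe_mul2l => /=.
  rewrite Radon_NikodymE//=; first exact: arclength_dominated.
  move=> dom; case: cid => /= h [h1 h2 h3].
  (* The abstract density and J on the period have the same integral over every measurable set, by
     the definition of [arclength]. *)
  apply: integral_ae_eq => // A _ mA.
  transitivity (arclength m rho0 delta A); first by rewrite -h3.
  by rewrite /arclength integral_mkcondr.
apply: eq_integral => t _; rewrite !patchE; case: ifPn => _; first by rewrite EFinM.
by rewrite mule0.
Qed.

Lemma Lnorm_arclength_le (f : R -> R) (M c : R) : measurable_fun setT f ->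
  (forall t, `|f t| <= M) -> (forall t, J m rho0 delta t <= c) ->
  ('N[sigma]_2%:E[EFin \o f] <= (M * Num.sqrt (c * (2 * pi)))%:E)%E.
Proof.
move=> mf fM Jc.
have M0 : 0 <= M := le_trans (normr_ge0 _) (fM 0).
have c0 : 0 <= c := le_trans (J_ge0 m rho0 delta 0) (Jc 0).
have cp0 : 0 <= c * (2 * pi) by rewrite mulr_ge0// ltW// twopi_gt0.
have -> : ((M * Num.sqrt (c * (2 * pi)))%:E = ((M ^+ 2 * (c * (2 * pi)))%:E `^ 2^-1))%E.
  rewrite poweR_EFin powR12_sqrt; last by rewrite mulr_ge0// exprn_ge0.
  by rewrite [in RHS]sqrtrM ?exprn_ge0// sqrtr_sqr ger0_norm.
rewrite unlock; apply: gt0_ler_poweR; first by rewrite invr_ge0.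
- by rewrite in_itv/= integral_ge0 ?leey// => x _; exact: poweR_ge0.
- by rewrite in_itv/= lee_fin mulr_ge0 ?exprn_ge0// leey.
apply: (@le_trans _ _ (\int[sigma]_t (cst (M ^+ 2)%:E) t)%E).
  apply: ge0_le_integral => //.
  - by move=> t _; exact: poweR_ge0.
  - apply: (@measurableT_comp _ _ _ _ _ _ (@poweR R ^~ 2)); first exact: measurable_poweR.
    by apply: measurableT_comp => //; exact/measurable_EFinP.
  - move=> t _ /=; rewrite lee_fin powR_mulrn//.
    by rewrite lerXn2r// nnegrE.
rewrite integral_cst// [leRHS]EFinM lee_wpmul2l ?lee_fin ?exprn_ge0//.
exact: arclength_le.
Qed.

Lemma Lfun_arclength (f : R -> R) (M : R) : measurable_fun setT f ->
  (forall t, `|f t| <= M) -> f \in Lfun sigma 2%:E.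
Proof.
move=> mf fM; apply/andP; rewrite !inE; split => //.
apply: le_lt_trans (Lnorm_arclength_le _ _ _ mf fM J_le) _.
by rewrite ltry.
Qed.

End arclength.

(** * The Neumann-Poincare operator on sine series *)

Section Kstar.
Context {R : realType}.
Variables (m : nat) (rho0 delta : R).
Hypothesis deltam : `|delta| * m%:R <= 2^-1.
Local Notation E := (@sine_closure R).
Local Notation J := (J m rho0 delta).
Local Notation sigma := (arclength m rho0 delta).
Local Notation mu := (@lebesgue_measure R).
Local Notation D := (`[0%R, (2 * pi)%R[%classic : set R).

Lemma continuous_measurable (f : R -> R) : continuous f -> measurable_fun setT f.
Proof. by move=> cf; exact: continuous_measurable_fun. Qed.

Lemma J_neq0 t : J t != 0.
Proof. by rewrite gt_eqF// J_gt0. Qed.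

Lemma continuous_invJ : continuous (fun t => (J t)^-1).
Proof. by move=> t; apply: cvgV; [exact: J_neq0|exact: continuous_J]. Qed.

Lemma invJ_le t : `|(J t)^-1| <= 2 / expR rho0.
Proof.
rewrite ger0_norm ?invr_ge0 ?J_ge0//.
have /andP[h _] := J_bounds m rho0 delta deltam t.
rewrite -[leRHS]invrK invfM invrK mulrC lef_pV2//; rewrite posrE.
- exact: J_gt0.
- by rewrite divr_gt0// expR_gt0.
Qed.

Lemma invJ_mul_le f (c : R) t : (forall x, `|f x| <= c) ->
  `|(J t)^-1 * f t| <= 2 / expR rho0 * c.
Proof. by move=> fc; rewrite normrM ler_pM// invJ_le. Qed.

Lemma measurable_invJ_mul f : continuous f ->
  measurable_fun setT (fun t => (J t)^-1 * f t).
Proof.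
move=> cf; apply: continuous_measurable; apply: continuous_mul => //.
exact: continuous_invJ.
Qed.

Lemma measurable_expi_eq (t : R) : measurable_fun setT (fun x : R => expi t == expi x).
Proof.
under eq_fun do rewrite eq_complex /=.
apply: measurable_and; apply: measurable_fun_eqr => //.
  by apply: continuous_measurable; exact: continuous_cos.
by apply: continuous_measurable; exact: continuous_sin.
Qed.

Lemma expi_eq_negligible (t : R) : \forall x \ae mu, D x -> expi t != expi x.
Proof.
have [[x0 [Dx0 tx0]]|none] := pselect (exists x0, D x0 /\ expi t = expi x0).
  exists [set x0]; split => //; first exact: lebesgue_measure_set1.
  move=> x /= /not_implyP[Dx /negP]; rewrite negbK => /eqP tx.
  by apply: expi_inj; rewrite -?tx//; move: Dx Dx0; rewrite /= !in_itv.
exists set0; split => // x /= /not_implyP[Dx /negP]; rewrite negbK => /eqP tx.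
by case: none; exists x.
Qed.

(** The density J of arc length cancels the J^-1 of the argument, which leaves a period integral of
    f against the kernel of [boundary_kernelE], whose constant part annihilates f. *)
Lemma KstarE f t : E f ->
  Kstar m rho0 delta (fun x => (J x)^-1 * f x) t =
  (J t)^-1 * (delta * kernel_op (dwave_sum m) f t +
              delta ^+ 2 * kernel_op (remainder_kernel m delta) f t).
Proof.
move=> Ef; rewrite /Kstar /NP.
have cf := sine_closure_continuous _ Ef.
have [M fM] := sine_closure_bounded _ Ef.
pose H x := delta%:C * dwave_sum m t x +
  (delta ^+ 2)%:C * remainder_kernel m delta t x.
have cP := continuousC_dwave_sum m t.
have cQ := continuousC_remainder_kernel m delta deltam t.
have cH : continuousC H.
  by apply: continuousC_add; apply: continuousC_mul => //; exact: continuousC_cst.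
pose KH : R := `|delta| * (m%:R * m%:R) + `|delta ^+ 2| * (m%:R * m%:R * m%:R * 2).
have bH x : normc (H x) <= KH.
  apply: le_trans (le_normcD _ _) _; apply: lerD.
    by rewrite normcM normc_real ler_wpM2l// normc_dwave_sum.
  by rewrite normcM normc_real ler_wpM2l// normc_remainder_kernel.
pose c x := 2^-1 + complex.Re (H x).
have cc : continuous c.
  by apply: continuous_add; [exact: continuous_const|exact: cH.1].
pose g x := (if expi t == expi x then 0 else (J t)^-1 * c x) * ((J x)^-1 * f x).
have mg : measurable_fun setT g.
  apply: measurable_funM; last exact: measurable_invJ_mul.
  apply: measurable_fun_ifT; first exact: measurable_expi_eq.
    exact: measurable_cst.
  apply: continuous_measurable; apply: continuous_mul => //.
  exact: continuous_const.
have bg x : `|g x| <= 2 / expR rho0 * (2^-1 + KH) * (2 / expR rho0 * M).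
  rewrite normrM; apply: ler_pM => //; last exact: invJ_mul_le.
  have e0 : 0 <= 2 / expR rho0 by rewrite divr_ge0// expR_ge0.
  have bc : `|c x| <= 2^-1 + KH.
    apply: le_trans (ler_normD _ _) _; apply: lerD; first by rewrite ger0_norm.
    exact: le_trans (Re_le_normc _) (bH x).
  case: ifP => _; last by rewrite normrM ler_pM// invJ_le.
  by rewrite normr0 mulr_ge0// (le_trans (normr_ge0 _) bc).
have -> : \int[sigma]_y (dotC (bdry m rho0 delta t - bdry m rho0 delta y)
     (normal m rho0 delta t) / absC (bdry m rho0 delta t - bdry m rho0 delta y)
       ^+ 2 * ((J y)^-1 * f y)) = \int[sigma]_y g y.
  by congr Rintegral; apply/funext => y; rewrite boundary_kernelE.
have mD : measurable D by exact: measurable_itv.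
have -> : \int[sigma]_y g y = \int[mu]_(y in D) ((J t)^-1 * (c y * f y)).
  rewrite /Rintegral (integral_arclength m rho0 delta _ _ mg bg); congr fine.
  apply: ae_eq_integral => //.
  - apply: measurable_funTS; apply/measurable_EFinP; apply: measurable_funM => //.
    exact: measurable_J.
  - apply: measurable_funTS; apply/measurable_EFinP; apply: continuous_measurable.
    by apply: continuous_mul; [exact: continuous_const|exact: continuous_mul].
  have [N [mN N0 sN]] := expi_eq_negligible t.
  exists N; split => //; apply: subset_trans sN => y /=.
  apply: contra_not => ty Dy.
  rewrite /g (negbTE (ty Dy)); congr (_%:E).
  have := J_neq0 y; have := J_neq0 t; move: (J y) (J t) => Jy Jt Jt0 Jy0.
  by field; rewrite Jt0 Jy0.
have cJcf : continuous (fun y : R => (J t)^-1 * (c y * f y)).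
  by apply: continuous_mul; [exact: continuous_const|exact: continuous_mul].
rewrite Rintegral_itv_bndo_bndc; last first.
  apply: (integrableS _ _ _ (int_period_integrable _ cJcf)) => //.
  by apply: subset_itvl; rewrite bnd_simp.
rewrite -/(int_period (fun y => (J t)^-1 * (c y * f y))).
rewrite int_periodZ; last exact: continuous_mul.
rewrite mulrCA; congr (_ * _).
(* The constant 1/2 is written with cos (0 y), so that [sine_closure_orthogonal] applies at q =
   0. *)
have -> : (fun y => c y * f y) = fun y => 2^-1 * (cos (0%:R * y) * f y) +
   (delta * (complex.Re (dwave_sum m t y) * f y) +
    delta ^+ 2 * (complex.Re (remainder_kernel m delta t y) * f y)).
  apply/funext => y; rewrite mul0r cos0 mul1r /c /H Re_add !Re_scale; ring.
have c1 : continuous (fun y : R => cos (0%:R * y) * f y).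
  by apply: continuous_mul => //; exact: continuous_cosM.
have c2 : continuous (fun y : R => complex.Re (dwave_sum m t y) * f y).
  by apply: continuous_mul => //; exact: cP.1.
have c3 : continuous (fun y : R => complex.Re (remainder_kernel m delta t y) * f y).
  by apply: continuous_mul => //; exact: cQ.1.
have cZ (a : R) h : continuous h -> continuous (fun y : R => a * h y).
  by move=> ch; apply: continuous_mul => //; exact: continuous_const.
rewrite int_periodD; [|exact: cZ|by apply: continuous_add; exact: cZ].
rewrite int_periodD; [|exact: cZ|exact: cZ].
rewrite !int_periodZ// sine_closure_orthogonal// mulr0 add0r /kernel_op.
by ring.
Qed.

Lemma Vs_invJ f : E f -> Vs m rho0 delta (fun t => (J t)^-1 * f t).
Proof.
move=> Ef; have cf := sine_closure_continuous _ Ef.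
have [M fM] := sine_closure_bounded _ Ef.
split.
  apply: (@Lfun_arclength _ _ _ _ _ (2 / expR rho0 * M)).
    exact: measurable_invJ_mul.
  by move=> t; exact: invJ_mul_le.
move=> e e0.
pose L := 2 / expR rho0 * Num.sqrt (expR rho0 * 2 * (2 * pi)).
have L0 : 0 <= L by rewrite /L mulr_ge0// ?sqrtr_ge0// divr_ge0// expR_ge0.
have [N [c Hc]] := Ef (e / (L + 1)) (divr_gt0 e0 (ltr_wpDl L0 ltr01)).
exists N, c.
pose h t := f t - \sum_(1 <= n < N.+1) c n * sin (n%:R * t).
have -> : (fun t => (J t)^-1 * f t) \-
    (fun x => \sum_(1 <= n < N.+1) c n * vs m rho0 delta n x)
    = fun t => (J t)^-1 * h t.
  apply/funext => t; rewrite /h mulrBr mulr_sumr /=; congr (_ - _).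
  by apply: eq_bigr => n _; rewrite /vs mulrCA.
apply: le_lt_trans (Lnorm_arclength_le m rho0 delta _
    (2 / expR rho0 * (e / (L + 1))) (expR rho0 * 2) _ _ _) _.
- apply: measurable_invJ_mul => x; apply: cvgB; first exact: cf.
  exact: continuous_sine_sum.
- by move=> t; exact: invJ_mul_le.
- by move=> t; have /andP[] := J_bounds m rho0 delta deltam t.
rewrite lte_fin mulrAC -/L mulrA ltr_pdivrMr; last by rewrite ltr_wpDl.
by rewrite mulrC ltr_pM2l// ltrDl.
Qed.

(** Sine coefficients depend only on the class modulo null sets; this is how eigenfunctions are seen
    to be nontrivial. *)
Lemma invJ_ae_eq0 f n : E f ->
  (fun t => (J t)^-1 * f t) = cst 0 %[ae sigma] ->
  int_period (fun x => sin (n%:R * x) * f x) = 0.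
Proof.
move=> Ef f0; have cf := sine_closure_continuous _ Ef.
have [M fM] := sine_closure_bounded _ Ef.
have mD : measurable D by exact: measurable_itv.
have csf : continuous (fun x : R => sin (n%:R * x) * f x).
  by apply: continuous_mul => //; exact: continuous_sinM.
rewrite /int_period -Rintegral_itv_bndo_bndc; last first.
  apply: (integrableS _ _ _ (int_period_integrable _ csf)) => //.
  by apply: subset_itvl; rewrite bnd_simp.
pose g t := (J t)^-1 * (sin (n%:R * t) * f t).
have mg : measurable_fun setT g by exact: measurable_invJ_mul.
have bg t : `|g t| <= 2 / expR rho0 * M.
  apply: (invJ_mul_le (fun t => sin (n%:R * t) * f t)) => x.
  rewrite normrM -[leRHS]mul1r ler_pM//.
  by rewrite ler_norml sin_le1 sin_geN1.
have -> : \int[mu]_(x in D) (sin (n%:R * x) * f x) = \int[sigma]_x g x.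
  rewrite /Rintegral (integral_arclength m rho0 delta _ _ mg bg); congr fine.
  apply: eq_integral => x _; congr (_%:E); rewrite /g.
  by have := J_neq0 x; move: (J x) => Jx Jx0; field.
rewrite /Rintegral (ae_eq_integral (cst 0%E))//.
- by rewrite integral0.
- exact/measurable_EFinP.
- have [N [mN N0 sN]] := f0.
  exists N; split => //; apply: subset_trans sN => x /=.
  by apply: contra_not => h _; congr (_%:E); rewrite /g mulrCA h// mulr0.
Qed.

End Kstar.

(** * The leading operator and its eigenvectors *)

Section first_order_operator.
Context {R : realType} {m : nat}.
Local Notation E := (@sine_closure R).

Definition sine_mode (i : 'I_m) (t : R) : R := sin (i.+1%:R * t).

Definition sine_coef (i : 'I_m) (f : R -> R) : R :=
  pi^-1 * int_period (fun x => sin (i.+1%:R * x) * f x).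

(** The index i stands for the frequency n = i + 1 and [rev_ord i] for m + 1 - n. The leading
    operator sends mode i to [mode_weight (rev_ord i)] times mode [rev_ord i]. *)
Definition mode_weight (i : 'I_m) : R := - (i.+1%:R / 2).

Lemma sine_mode_closed i : E (sine_mode i).
Proof. exact: sine_closure_sin. Qed.

Lemma sine_mode_le1 i t : `|sine_mode i t| <= 1.
Proof. by rewrite ler_norml sin_le1 sin_geN1. Qed.

Lemma sine_coef_linear i : linear_on E (sine_coef i : _ -> R^o).
Proof.
move=> a f g Ef Eg.
have [cf cg] := (sine_closure_continuous _ Ef, sine_closure_continuous _ Eg).
rewrite /sine_coef scale_reg.
have cs h : continuous h -> continuous (fun x : R => sin (i.+1%:R * x) * h x).
  by move=> ch; apply: continuous_mul => //; exact: continuous_sinM.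
have cas : continuous (fun x : R => a * (sin (i.+1%:R * x) * f x)).
  by apply: continuous_mul; [exact: continuous_const|exact: cs].
rewrite mulrCA -mulrDr -(int_periodZ a); last exact: cs.
rewrite -int_periodD//; last exact: cs.
congr (_ * _); congr int_period; apply/funext => x.
by rewrite -[(a *: f + g) x]/(a * f x + g x); ring.
Qed.

Lemma sine_coef_mode i k : sine_coef i (sine_mode k) = (i == k)%:R.
Proof.
rewrite /sine_coef int_period_sin_sin// mulrCA mulVf ?mulr1 ?eqSS//.
by rewrite gt_eqF// pi_gt0.
Qed.

Lemma sine_coef_le i f (c : R) : E f -> (forall t, `|f t| <= c) ->
  `|sine_coef i f| <= 2 * c.
Proof.
move=> Ef fc; have cf := sine_closure_continuous _ Ef.
have p0 := @pi_gt0 R.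
rewrite /sine_coef normrM ger0_norm; last by rewrite invr_ge0 ltW.
rewrite mulrC ler_pdivrMr// mulrAC.
apply: int_period_le.
  by apply: continuous_mul => //; exact: continuous_sinM.
move=> x; rewrite normrM -[leRHS]mul1r ler_pM//.
by rewrite ler_norml sin_le1 sin_geN1.
Qed.

Lemma first_order_operatorE f : E f -> kernel_op (dwave_sum m) f =
  \sum_p sine_coef p f *: (mode_weight (rev_ord p) *: sine_mode (rev_ord p)).
Proof.
move=> Ef; have cf := sine_closure_continuous _ Ef.
rewrite /dwave_sum kernel_op_sum//; last first.
  move=> i t; apply: continuousC_mul; first exact: continuousC_cst.
  exact: continuousC_expi.
rewrite (reindex_inj rev_ord_inj) /=.
under [RHS]eq_bigr do rewrite rev_ordK.
apply/funext => t; rewrite fct_sumE; apply: eq_bigr => i _.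
rewrite kernel_opZ//; last by move=> s; exact: continuousC_expi.
rewrite kernel_op_wave//.
rewrite -[RHS]/(sine_coef (rev_ord i) f * (mode_weight i * sine_mode i t)).
rewrite /sine_coef /mode_weight /sine_mode /= subnSK//.
have p0 : pi != 0 :> R by rewrite gt_eqF// pi_gt0.
move: (int_period _) (pi : R) p0 => I P P0; field; exact: P0.
Qed.

(** With n = p + 1 the product is n (m + 1 - n) / 4, which is symmetric about (m + 1) / 2 and
    strictly monotone on each side. This is the source of the simplicity of the nonzero
    eigenvalues. *)
Lemma mode_weight_resonant (j p : 'I_m) :
  (mode_weight p * mode_weight (rev_ord p) ==
   mode_weight j * mode_weight (rev_ord j)) = (p == j) || (p == rev_ord j).
Proof.
have weightE (i : 'I_m) : mode_weight i * mode_weight (rev_ord i) =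
    (i.+1 * (m - i))%:R / 4.
  by rewrite /mode_weight /= subnSK// natrM; field.
rewrite !weightE (inj_eq (mulIf _)) ?invr_eq0 ?pnatr_eq0// eqr_nat.
rewrite -!val_eqE /=.
have := ltn_ord p; have := ltn_ord j.
move: (nat_of_ord p) (nat_of_ord j) => a c am cm.
apply/eqP/orP => [h|[/eqP ->|/eqP ->]]; [|by []|by nia].
have [->|ac] := eqVneq a c; [by left|right; apply/eqP].
by have : (a < c \/ c < a)%N by [lia]; case; nia.
Qed.

Local Notation A := (kernel_op (dwave_sum m)).

Let linE := @sine_closure_linear R.
Let E0 : E 0 := @sine_closure0 R.

Let linA : linear_on E A.
Proof. by apply: kernel_op_linear => t; exact: continuousC_dwave_sum. Qed.

(** x1, x2 are the coordinates of the eigenvector on modes j and [rev_ord j], y1, y2 those of the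
    left eigenvector b, and the last equation says b g0 = 1. Its cross terms count only when j is
    its own reversal, so that the paired modes and the middle mode are treated together. *)
Lemma eigen_expansion_of_simple (rho0 nu x1 x2 y1 y2 : R) (j : 'I_m) :
  nu != 0 -> y1 != 0 -> y2 != 0 ->
  x1 * mode_weight (rev_ord j) = nu * x2 -> x2 * mode_weight j = nu * x1 ->
  y1 * mode_weight j = nu * y2 -> y2 * mode_weight (rev_ord j) = nu * y1 ->
  x1 * y1 + x2 * y2 + (x1 * y2 + x2 * y1) * (j == rev_ord j)%:R = 1 ->
  eigen_expansion m rho0 (fun delta => delta * nu)
    (fun delta t => (J m rho0 delta t)^-1 *
       (x1 * sine_mode j t + x2 * sine_mode (rev_ord j) t)).
Proof.
move=> nu0 y10 y20 ex1 ex2 ey1 ey2 xy.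
set j' := rev_ord j in ex1 ex2 ey1 ey2 xy *.
pose g0 : R -> R := x1 *: sine_mode j + x2 *: sine_mode j'.
pose b f := y1 * sine_coef j f + y2 * sine_coef j' f.
pose G := reduced_resolvent sine_mode sine_coef mode_weight nu.
have EZ := combination_closedZ E linE E0.
have ED := combination_closedD E linE.
have Eg0 : E g0 by apply: ED; apply: EZ; exact: sine_mode_closed.
have nu2 : mode_weight j * mode_weight j' = nu ^+ 2.
  apply: (mulfI y10); rewrite mulrA ey1 -mulrA ey2; ring.
have Amode p : A (sine_mode p) = mode_weight (rev_ord p) *: sine_mode (rev_ord p).
  exact: (A_s E sine_mode sine_coef mode_weight A sine_mode_closed
    sine_coef_mode first_order_operatorE).
have Ag0 : A g0 = nu *: g0.
  rewrite /g0 (linear_onD E _ _ linA); [|by apply: EZ; exact: sine_mode_closed..].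
  rewrite !(linear_onZ E E0 _ _ linA); [|exact: sine_mode_closed..].
  rewrite !Amode rev_ordK -/j' !scalerDr !scalerA ex1 ex2 addrC.
  by rewrite -/j'.
have linb : linear_on E (b : _ -> R^o).
  move=> a f g Ef Eg; rewrite /b !sine_coef_linear// !scale_reg; ring.
have coefA i f : E f -> sine_coef i (A f) = mode_weight i * sine_coef (rev_ord i) f.
  exact: (alpha_A E sine_mode sine_coef mode_weight A linE E0
    sine_mode_closed sine_coef_linear sine_coef_mode first_order_operatorE).
have bA f : E f -> b (A f) = nu * b f.
  move=> Ef; rewrite /b !coefA// rev_ordK -/j' !mulrA ey1 ey2; ring.
have bg0 : b g0 = 1.
  rewrite /b /g0 !sine_coef_linear ?(linear_onZ E E0 _ _ (sine_coef_linear _));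
    try exact: sine_mode_closed; try (apply: EZ; exact: sine_mode_closed).
  apply: etrans xy; rewrite !sine_coef_mode !eqxx !scale_reg [j' == j]eq_sym.
  by have -> : true%:R = 1 :> R by []; ring.
have bb f (c : R) : E f -> (forall t, `|f t| <= c) ->
    `|b f| <= ((`|y1| + `|y2|) * 2) * c.
  move=> Ef fc; apply: le_trans (ler_normD _ _) _.
  rewrite -mulrA mulrDl.
  by apply: lerD; rewrite normrM; apply: ler_wpM2l => //; exact: sine_coef_le.
have Gb f : E f -> b f = 0 -> b (G f) = 0 /\ A (G f) = nu *: G f + f.
  move=> Ef bf; split.
    apply: (reduced_resolvent_ker E sine_mode sine_coef mode_weight A nu linE E0
      sine_mode_closed sine_coef_mode first_order_operatorE nu0 b) => //.
  apply: (reduced_resolventP E sine_mode sine_coef mode_weight A nu linE E0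
      sine_mode_closed linA sine_coef_mode first_order_operatorE nu0) => //.
  (* For j != j', the left sides of [h1] and [h2] are the coordinates on modes j and j' of A + nu
     applied to the resonant part of f; both are proportional to b f. *)
  have h1 : nu * sine_coef j f + mode_weight j * sine_coef j' f = 0.
    apply: (mulfI y20); rewrite mulr0 -(mulr0 (mode_weight j)) -bf /b.
    rewrite !mulrDr !mulrA [mode_weight j * y1]mulrC ey1; ring.
  have h2 : mode_weight j' * sine_coef j f + nu * sine_coef j' f = 0.
    apply: (mulfI y10); rewrite mulr0 -(mulr0 (mode_weight j')) -bf /b.
    rewrite !mulrDr !mulrA [mode_weight j' * y2]mulrC ey2; ring.
  under eq_bigl do rewrite -nu2 mode_weight_resonant -/j'.
  rewrite (bigD1 j) ?eqxx//=.
  have [jj'|jj'] := eqVneq j j'.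
    rewrite big1 => [|p]; last by rewrite -jj' orbb => /andP[->].
    rewrite addr0 -/j' -jj' -scalerDl scalerA.
    by move: h2; rewrite -jj' -mulrDl mulrC => ->; rewrite scale0r.
  rewrite (bigD1 j') ?eqxx ?orbT 1?eq_sym//= big1 => [|p]; last first.
    by move=> /andP[/andP[/orP[/eqP ->|/eqP ->]]]; rewrite eqxx.
  rewrite addr0 rev_ordK -/j'; apply/funext => t.
  rewrite -[LHS]/(sine_coef j f * (mode_weight j' * sine_mode j' t + nu * sine_mode j t)
    + sine_coef j' f * (mode_weight j * sine_mode j t + nu * sine_mode j' t)).
  rewrite -[RHS]/(0 : R).
  transitivity ((nu * sine_coef j f + mode_weight j * sine_coef j' f) * sine_mode j t
    + (mode_weight j' * sine_coef j f + nu * sine_coef j' f) * sine_mode j' t).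
    by ring.
  by rewrite h1 h2 !mul0r addr0.
have bcoef f : (forall i, sine_coef i f = 0) -> b f = 0.
  by move=> h; rewrite /b !h !mulr0 addr0.
have [KG KG0 bG] := reduced_resolvent_bounded E sine_mode sine_coef mode_weight
  nu 2 sine_mode_le1 sine_coef_le.
have [Kg bg] := sine_closure_bounded _ Eg0.
have Kg0 : 0 <= Kg := le_trans (normr_ge0 _) (bg 0).
pose Kb : R := (`|y1| + `|y2|) * 2.
have Kb0 : 0 <= Kb by rewrite /Kb mulr_ge0// addr_ge0.
pose KQ : R := m%:R * m%:R * m%:R * 2.
have KQ0 : 0 <= KQ by rewrite /KQ !mulr_ge0.
(* K does not involve delta, since the bound [KQ] on the remainder kernel is uniform; hence one C
   serves all small delta. *)
pose K := KG + Kb + Kg + KQ.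
have K0 : 0 <= K by rewrite /K !addr_ge0.
have c_ge0 (f : R -> R) (c : R) : (forall t, `|f t| <= c) -> 0 <= c.
  by move=> fc; apply: le_trans (fc 0).
have widen (K' c : R) (f : R -> R) (x : R) : K' <= K -> (forall t, `|f t| <= c) ->
    x <= K' * c -> x <= K * c.
  move=> KK fc /le_trans; apply; rewrite ler_wpM2r//; exact: c_ge0 fc.
have [C [e [e0 H]]] : exists C e : R, 0 < e /\
    forall (Q : (R -> R) -> (R -> R)) (delta : R),
      (forall f, E f -> E (Q f)) -> linear_on E Q ->
      (forall f (c : R), E f -> (forall t, `|f t| <= c) ->
         forall t, `|Q f t| <= K * c) ->
      `|delta| <= e ->
      exists (u : R -> R) (r : R), [/\ E u, b u = 0,
        forall t, `|u t| <= C * `|delta|, `|r| <= C &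
        A (g0 + u) + delta *: Q (g0 + u) = (nu + delta * r) *: (g0 + u)].
  apply: (simple_eigenvalue_perturbation E A G b g0 nu K) => //.
  - exact: sine_closure_uniformly_closed.
  - exact: (reduced_resolvent_closed E sine_mode sine_coef mode_weight nu
      linE E0 sine_mode_closed).
  - exact: (reduced_resolvent_linear E sine_mode sine_coef mode_weight nu
      sine_coef_linear).
  - move=> f c Ef fc t; apply: (widen KG _ f) => //; last exact: bG.
    by rewrite /K -!addrA lerDl !addr_ge0.
  - move=> f c Ef fc; apply: (widen Kb _ f) => //; last exact: bb.
    by rewrite /K -addrA addrAC lerDr !addr_ge0.
  - move=> t; apply: le_trans (bg t) _.
    by rewrite /K addrAC lerDr !addr_ge0.
(* The second bound gives |delta| m <= 1/2, which keeps 1 - delta S away from 0 and J positive. *)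
pose e1 := Num.min e (2 * (m%:R + 1))^-1.
have e10 : 0 < e1.
  by rewrite /e1 lt_min e0 invr_gt0 mulr_gt0// ltr_wpDl.
have small (delta : R) : `|delta| <= e1 -> `|delta| * m%:R <= 2^-1 :> R.
  rewrite /e1 le_min => /andP[_ h].
  apply: le_trans (ler_wpM2r (ler0n _ m) h) _.
  rewrite mulrC ler_pdivrMr ?mulr_gt0 ?ltr_wpDl//.
  by rewrite mulrA mulVf// mul1r lerDl.
pose L : R := 2 / expR rho0 * Num.sqrt (expR rho0 * 2 * (2 * pi)).
have L0 : 0 <= L by rewrite /L mulr_ge0// ?sqrtr_ge0// divr_ge0// expR_ge0.
(* The radius condition sits inside the existential so that [choice] yields functions of every
   delta; beyond e1 any pair will do. *)
have Hdelta delta : exists p : R * (R -> R), `|delta| <= e1 ->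
    [/\ is_eigenpair (arclength m rho0 delta) (Kstar m rho0 delta)
          (Vs m rho0 delta) p.1 p.2,
        `|p.1 - delta * nu| <= (C + C * L) * delta ^+ 2 &
        ('N[arclength m rho0 delta]_2%:E[EFin \o (p.2 \- fun t =>
            (J m rho0 delta t)^-1 * (x1 * sine_mode j t + x2 * sine_mode j' t))%R]
          <= ((C + C * L) * `|delta|)%:E)%E].
  have [dle|_] := leP `|delta| e1; last by exists (0, cst 0).
  have dm := small _ dle.
  pose Q := kernel_op (remainder_kernel m delta).
  have cQ := continuousC_remainder_kernel m delta dm.
  have [||||u [r [Eu bu uC rC eq]]] := H Q delta.
  - by move=> f Ef; exact: sine_closure_remainder.
  - exact: kernel_op_linear.
  - move=> f c Ef fc t; apply: (widen KQ _ f) => //.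
      by rewrite /K lerDr !addr_ge0.
    apply: kernel_op_le => //; first exact: sine_closure_continuous.
    by move=> x; exact: normc_remainder_kernel.
  - by move: dle; rewrite /e1 le_min => /andP[].
  have C0 : 0 <= C := le_trans (normr_ge0 _) rC.
  have Ef : E (g0 + u) by exact: ED.
  exists (delta * (nu + delta * r), fun t => (J m rho0 delta t)^-1 * (g0 + u) t) => _.
  split => /=.
  - split; first exact: Vs_invJ.
      (* A negligible eigenfunction would have zero sine coefficients, whereas b (g0 + u) = b g0 =
         1. *)
      move=> f0; have : b (g0 + u) = 0.
        apply: bcoef => i; rewrite /sine_coef.
        by rewrite (invJ_ae_eq0 m rho0 delta dm _ i.+1 Ef f0) mulr0.
      by rewrite (linear_onD E _ _ linb)// bg0 bu addr0 => /eqP; rewrite oner_eq0.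
    rewrite (_ : Kstar _ _ _ _ = fun t => delta * (nu + delta * r) *
        ((J m rho0 delta t)^-1 * (g0 + u) t)); first exact: ae_eq_refl.
    apply/funext => t; rewrite KstarE// [RHS]mulrCA; congr (_ * _).
    have := congr1 (fun h => delta * h t) eq.
    rewrite -[(A (g0 + u) + delta *: Q (g0 + u)) t]/(A (g0 + u) t + delta * Q (g0 + u) t).
    rewrite -[((nu + delta * r) *: (g0 + u)) t]/((nu + delta * r) * (g0 + u) t).
    move=> h; rewrite -[RHS]mulrA -h /Q.
    by move: (kernel_op _ _ t) (kernel_op _ _ t) => a c; ring.
  - rewrite (_ : _ - _ = delta ^+ 2 * r); last by ring.
    rewrite normrM ger0_norm ?sqr_ge0// mulrC ler_wpM2r ?sqr_ge0//.
    by apply: le_trans rC _; rewrite lerDl mulr_ge0.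
  - rewrite (_ : (_ \- _) = fun t => (J m rho0 delta t)^-1 * u t); last first.
      apply/funext => t /=.
      rewrite -[(g0 + u) t]/(x1 * sine_mode j t + x2 * sine_mode j' t + u t).
      by ring.
    apply: le_trans (Lnorm_arclength_le m rho0 delta _
      (2 / expR rho0 * (C * `|delta|)) (expR rho0 * 2) _ _ _) _.
    + apply: measurable_invJ_mul => //; exact: sine_closure_continuous.
    + by move=> t; exact: invJ_mul_le.
    + by move=> t; have /andP[] := J_bounds m rho0 delta dm t.
    rewrite lee_fin mulrAC -/L mulrA ler_wpM2r// mulrC lerDr//.
have [F HF] := choice Hdelta.
exists (fun delta => (F delta).1), (fun delta => (F delta).2), (C + C * L).
near=> delta; apply: HF; rewrite -[delta]subr0.
near: delta; apply: (@cvgr_distC_le _ _ _ _ _ id) => //.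
Unshelve. all: end_near.
Qed.

End first_order_operator.

(** * The paired modes and the middle mode *)

Lemma eigen_expansion_pair (R : realType) (m : nat) (rho0 : R) (j : nat)
    (s : bool) : (1 <= j <= m)%N -> (j != m + 1 - j)%N ->
  eigen_expansion m rho0
    (fun delta => - (delta / 2) * ((-1) ^+ s * Num.sqrt (j * (m + 1 - j))%:R))
    (fun delta t =>
       Num.sqrt j%:R * vs m rho0 delta j t
       + (-1) ^+ s * Num.sqrt (m + 1 - j)%:R * vs m rho0 delta (m + 1 - j) t).
Proof.
move=> /andP[j1 jm] jneq.
have lt : (j.-1 < m)%N by rewrite prednK.
pose i := Ordinal lt.
have e1 : i.+1 = j by rewrite /= prednK.
have e2 : (rev_ord i).+1 = (m + 1 - j)%N by rewrite /=; lia.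
pose a : R := Num.sqrt j%:R; pose c : R := Num.sqrt (m + 1 - j)%:R.
have a2 : a ^+ 2 = j%:R by rewrite sqr_sqrtr.
have c2 : c ^+ 2 = (m + 1 - j)%:R by rewrite sqr_sqrtr.
have a0 : a != 0 by rewrite gt_eqF// sqrtr_gt0 ltr0n.
have c0 : c != 0 by rewrite gt_eqF// sqrtr_gt0 ltr0n; lia.
have wa : mode_weight i = - (a ^+ 2 / 2) by rewrite /mode_weight e1 a2.
have wc : mode_weight (rev_ord i) = - (c ^+ 2 / 2).
  by rewrite /mode_weight e2 c2.
have ine : (i == rev_ord i) = false.
  by apply/negbTE; apply: contra jneq => /eqP ii; rewrite -e2 -ii e1.
pose eps : R := (-1) ^+ s.
have eps2 : eps * eps = 1 by rewrite -expr2 sqrr_sign.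
have eps0 : eps != 0 by rewrite signr_eq0.
(* The block is antidiagonal with weights - a^2 / 2 and - c^2 / 2. For the eigenvalue - eps a c / 2
   its right eigenvector is (a, eps c) and its left one (1 / (2 a), eps / (2 c)), with pairing 1/2 +
   1/2. *)
have := @eigen_expansion_of_simple R m rho0 (- (2^-1 * (eps * (a * c))))
  a (eps * c) (2 * a)^-1 (eps * (2 * c)^-1) i.
rewrite wa wc ine.
have -> : (fun delta => delta * - (2^-1 * (eps * (a * c)))) =
    (fun delta => - (delta / 2) * ((-1) ^+ s * Num.sqrt (j * (m + 1 - j))%:R)).
  by apply/funext => delta; rewrite natrM sqrtrM// -/a -/c -/eps; field.
have -> : (fun delta t => (J m rho0 delta t)^-1 *
       (a * sine_mode i t + eps * c * sine_mode (rev_ord i) t)) =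
    (fun delta t =>
       Num.sqrt j%:R * vs m rho0 delta j t
       + (-1) ^+ s * Num.sqrt (m + 1 - j)%:R * vs m rho0 delta (m + 1 - j) t).
  apply/funext => delta; apply/funext => t.
  by rewrite /sine_mode e1 e2 /vs -/a -/c -/eps; ring.
apply.
- by rewrite oppr_eq0 !mulf_neq0// invr_eq0.
- by rewrite invr_eq0 mulf_neq0.
- by rewrite mulf_neq0// invr_eq0 mulf_neq0.
- rewrite [RHS](_ : _ = - (2^-1 * ((eps * eps) * (a * c * c)))); last by ring.
  by rewrite eps2; field.
- by field.
- rewrite [RHS](_ : _ = - (eps * eps * (a / 4))); last by field; rewrite c0.
  by rewrite eps2; field; rewrite a0.
- by field; rewrite a0 c0.
- rewrite mulr0 addr0.
  rewrite [LHS](_ : _ = 2^-1 + eps * eps * 2^-1); last by field; rewrite a0 c0.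
  by rewrite eps2; field.
Qed.

Lemma eigen_expansion_middle (R : realType) (m k : nat) (rho0 : R) :
  (1 <= k)%N -> m = (2 * k - 1)%N ->
  eigen_expansion m rho0 (fun delta => - (delta / 2) * k%:R)
    (fun delta => vs m rho0 delta k).
Proof.
move=> k1 mk; have lt : (k.-1 < m)%N by lia.
pose i := Ordinal lt.
have e1 : i.+1 = k by rewrite /= prednK.
have ii : rev_ord i = i by apply/val_inj => /=; lia.
(* Since [rev_ord i = i], the mode is counted twice: the halves add up to one copy of it, and the
   pairing is four times 1/4. *)
have := @eigen_expansion_of_simple R m rho0 (mode_weight i) 2^-1 2^-1 2^-1 2^-1 i.
rewrite ii eqxx.
have -> : (fun delta : R => delta * mode_weight i) =
    (fun delta : R => - (delta / 2) * k%:R).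
  by apply/funext => delta; rewrite /mode_weight e1; field.
have -> : (fun delta t => (J m rho0 delta t)^-1 *
    (2^-1 * sine_mode i t + 2^-1 * sine_mode i t)) = fun delta => vs m rho0 delta k.
  apply/funext => delta; apply/funext => t.
  by rewrite /sine_mode e1 /vs; congr (_ * _); field.
have h0 : 2^-1 != 0 :> R by rewrite invr_eq0.
have w0 : mode_weight i != 0 :> R by rewrite /mode_weight oppr_eq0 mulf_neq0.
apply => //; try by rewrite mulrC.
have -> : true%:R = 1 :> R by [].
by field.
Qed.

Theorem theorem2p3 (R : realType) (m : nat) (rho0 : R) :
  (1 <= m)%N -> 0 < rho0 ->
  (forall k : nat, (1 <= k)%N -> m = (2 * k - 1)%N ->
     eigen_expansion m rho0
       (fun delta => - (delta / 2) * k%:R)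
       (fun delta => vs m rho0 delta k) /\
     (forall (j : nat) (s : bool), (1 <= j <= k - 1)%N ->
        eigen_expansion m rho0
          (fun delta =>
             - (delta / 2) * ((-1) ^+ s * Num.sqrt (j * (m + 1 - j))%:R))
          (fun delta t =>
             Num.sqrt j%:R * vs m rho0 delta j t
             + (-1) ^+ s * Num.sqrt (m + 1 - j)%:R
               * vs m rho0 delta (m + 1 - j) t))) /\
  (forall k : nat, (1 <= k)%N -> m = (2 * k)%N ->
     forall (j : nat) (s : bool), (1 <= j <= k)%N ->
        eigen_expansion m rho0
          (fun delta =>
             - (delta / 2) * ((-1) ^+ s * Num.sqrt (j * (m + 1 - j))%:R))
          (fun delta t =>
             Num.sqrt j%:R * vs m rho0 delta j t
             + (-1) ^+ s * Num.sqrt (m + 1 - j)%:R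
               * vs m rho0 delta (m + 1 - j) t)).
Proof.
move=> _ _; split => [k k1 mk|k k1 mk j s /andP[j1 jk]].
  split; first exact: eigen_expansion_middle.
  (* From j < k follows j < 2 k - j = m + 1 - j, so the two modes differ. *)
  by move=> j s /andP[j1 jk]; apply: eigen_expansion_pair; lia.
(* For m = 2 k the partner m + 1 - j is at least k + 1, hence different from j. *)
by apply: eigen_expansion_pair; lia.
Qed.
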